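(* (1) For every $m\ge1$, the functor $\mathrm{N}_m\colon\mathsf{Graph}\to\mathsf{cSet}$ is lax monoidal. (2) The functor $\mathrm{N}\colon\mathsf{Graph}\to\mathsf{cSet}$ is lax monoidal. Here $\mathsf{Graph}$ carries the monoidal structure $(\otimes,I_0)$ and $\mathsf{cSet}$ the geometric product $(\otimes,\square^0)$.
   Context: Graphs. A graph is a (possibly infinite) simple undirected graph without loops; write $v\sim w$ if $v,w$ are equal or joined by an edge. A graph map $f\colon G\to H$ is a function on vertices such that $v\sim w$ implies $f(v)\sim f(w)$; $\mathsf{Graph}$ is the resulting category. The product $G\otimes H$ has as vertices the pairs $(v,w)$, with $(v,w)\sim(v',w')$ iff ($v=v'$ and $w\sim w'$) or ($w=w'$ and $v\sim v'$); this is a symmetric monoidal product with unit the one-vertex graph $I_0$. $I_m$ has vertices $0,\dots,m$ and edges between $i$ and $i+1$; $I_\infty$ has vertex set $\mathbb{Z}$ and edges between $i$ and $i+1$. Cubical sets. The box category $\square$ has objects the posets $[1]^n=\{0\le1\}^n$, $n\ge0$, with morphisms generated by: faces $\partial_{i,\varepsilon}\colon[1]^{n-1}\to[1]^n$ inserting $\varepsilon\in\{0,1\}$ in position $i$; degeneracies $\sigma_i\colon[1]^n\to[1]^{n-1}$ deleting the $i$-th coordinate; connections $\gamma_{i,0},\gamma_{i,1}\colon[1]^n\to[1]^{n-1}$ replacing $x_i,x_{i+1}$ by their max and min respectively. $\mathsf{cSet}$ is the category of presheaves on $\square$; operators act on the right, and $\square^n$ is the representable presheaf of $[1]^n$. The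 geometric product on $\mathsf{cSet}$ is the monoidal product, cocontinuous in each variable, extending $[1]^m\otimes[1]^n=[1]^{m+n}$ along the Yoneda embedding (Day convolution), with unit $\square^0$. Nerves. For $m\ge1$, $(\mathrm{N}_mG)_n$ is the set of graph maps $I_m^{\otimes n}\to G$, with structure maps given by precomposition with: $\partial_{i,\varepsilon}$ inserting $\varepsilon m$ in position $i$; $\sigma_i$ deleting the $i$-th coordinate; $\gamma_{i,0}$, $\gamma_{i,1}$ replacing $v_i,v_{i+1}$ by their max and min. A graph map $f\colon I_\infty^{\otimes n}\to G$ is stable in all directions if there is $M\ge0$ such that for every $i$, the value of $f$ is unchanged when a coordinate $v_i>M$ is replaced by $M$ and when a coordinate $v_i<-M$ is replaced by $-M$. $\mathrm{N}G$ is the cubical set with $(\mathrm{N}G)_n$ the set of such maps, where $f\partial_{i,\varepsilon}$ is obtained by setting the $i$-th coordinate of $f$ equal to $(2\varepsilon-1)M$ for $M$ as in the stability condition, $f\sigma_i(v_1,\dots,v_{n+1})=f(v_1,\dots,v_{i-1},v_{i+1},\dots,v_{n+1})$, and $f\gamma_{i,0}$, $f\gamma_{i,1}$ send $(v_1,\dots,v_{n+1})$ to $f(v_1,\dots,v_{i-1},\max(v_i,v_{i+1}),v_{i+2},\dots)$ and $f(v_1,\dots,v_{i-1},\min(v_i,v_{i+1}),v_{i+2},\dots)$ respectively. Both functors act on graph maps by postcomposition. A functor $F\colon\mathscr{C}\to\mathscr{D}$ between monoidal categories is lax monoidal if there are natural transformations $Fc\otimes Fc'\to F(c\otimes c')$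 and $I_{\mathscr{D}}\to FI_{\mathscr{C}}$ satisfying the usual associativity and unitality conditions. *)

(* Defs.v *)
From mathcomp Require Import all_boot all_order all_algebra.
From mathcomp Require Import boolp zify.
From Stdlib Require Import Relation_Operators.

Set Implicit Arguments.
Unset Strict Implicit.
Unset Printing Implicit Defensive.

Definition tup (A : Type) (n : nat) : Type := 'I_n -> A.

Definition ins (A : Type) n (i : 'I_n.+1) (a : A) (x : tup A n) : tup A n.+1 :=
  fun j => if unlift i j is Some k then x k else a.

Definition del (A : Type) n (i : 'I_n.+1) (x : tup A n.+1) : tup A n :=
  fun k => x (lift i k).

(* x_i, x_{i+1} are replaced by op x_i x_{i+1}: the coordinate i+1 is deleted, and
   op x_i x_{i+1} is put in position i. *)
Definition mrg (A : Type) n (op : A -> A -> A) (i : 'I_n.+1) (x : tup A n.+2) :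
    tup A n.+1 :=
  fun k => if k == i then op (del (lift ord0 i) x i) (x (lift ord0 i))
           else del (lift ord0 i) x k.

Definition tcat (A : Type) m n (x : tup A m) (y : tup A n) : tup A (m + n) :=
  fun i => match split i with inl j => x j | inr k => y k end.
Definition tfst (A : Type) m n (x : tup A (m + n)) : tup A m :=
  fun j => x (lshift n j).
Definition tsnd (A : Type) m n (x : tup A (m + n)) : tup A n :=
  fun k => x (rshift m k).
Definition tcast (A : Type) m n (e : m = n) (x : tup A m) : tup A n :=
  fun i => x (cast_ord (esym e) i).

Notation bits := (tup bool).

(* The booleans true and false stand for 1 and 0, both as the elements of [1] and
   as the values of epsilon. *)
Definition face n (i : 'I_n.+1) (eps : bool) : bits n -> bits n.+1 := ins i eps.
Definition degen n (i : 'I_n.+1) : bits n.+1 -> bits n := @del bool n i.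
Definition conn n (i : 'I_n.+1) (eps : bool) : bits n.+2 -> bits n.+1 :=
  mrg (if eps then andb else orb) i.

Inductive boxgen : forall m n, (bits m -> bits n) -> Prop :=
  | boxgen_id n : boxgen (fun x : bits n => x)
  | boxgen_face n (i : 'I_n.+1) eps : boxgen (face i eps)
  | boxgen_degen n (i : 'I_n.+1) : boxgen (degen i)
  | boxgen_conn n (i : 'I_n.+1) eps : boxgen (conn i eps)
  | boxgen_comp k m n (g : bits m -> bits n) (f : bits k -> bits m) :
      boxgen g -> boxgen f -> boxgen (fun x => g (f x)).

Record box (m n : nat) : Type :=
  Box { bfun :> bits m -> bits n; bfunP : boxgen bfun }.

Definition bid n : box n n := Box (boxgen_id n).
Definition bcomp k m n (g : box m n) (f : box k m) : box k n :=
  Box (boxgen_comp (bfunP g) (bfunP f)).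
Definition bface n (i : 'I_n.+1) eps : box n n.+1 := Box (boxgen_face i eps).
Definition bdegen n (i : 'I_n.+1) : box n.+1 n := Box (boxgen_degen i).
Definition bconn n (i : 'I_n.+1) eps : box n.+2 n.+1 := Box (boxgen_conn i eps).

Lemma box_eq m n (f g : box m n) : (forall x, f x = g x) -> f = g.
Proof.
case: f g => [f fP] [g gP] /= fg.
have e : f = g by apply: funext.
by subst g; rewrite (Prop_irrelevance fP gP).
Qed.

Lemma bcompA j k m n (h : box m n) (g : box k m) (f : box j k) :
  bcomp h (bcomp g f) = bcomp (bcomp h g) f.
Proof. exact: box_eq. Qed.
Lemma bcomp1l m n (f : box m n) : bcomp (bid n) f = f.
Proof. exact: box_eq. Qed.
Lemma bcomp1r m n (f : box m n) : bcomp f (bid m) = f.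
Proof. exact: box_eq. Qed.

Lemma tfst_cat A m n (x : tup A m) (y : tup A n) : tfst (tcat x y) = x.
Proof.
apply: funext => i; rewrite /tfst /tcat.
by rewrite (unsplitK (inl i : 'I_m + 'I_n)).
Qed.
Lemma tsnd_cat A m n (x : tup A m) (y : tup A n) : tsnd (tcat x y) = y.
Proof.
apply: funext => i; rewrite /tsnd /tcat.
by rewrite (unsplitK (inr i : 'I_m + 'I_n)).
Qed.
Lemma tcat_fst_snd A m n (x : tup A (m + n)) : tcat (tfst x) (tsnd x) = x.
Proof.
apply: funext => i; rewrite /tcat /tfst /tsnd.
by case: split_ordP => j ->.
Qed.

Lemma boxgen_cast m n m' n' (em : m' = m) (en : n = n') (f : bits m -> bits n) :
  boxgen f -> boxgen (fun x : bits m' => tcast en (f (tcast em x))).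
Proof.
move=> fP; subst m' n'.
suff -> : (fun x : bits m => tcast erefl (f (tcast erefl x))) = f by [].
apply: funext => x; rewrite /tcast; apply: funext => i.
rewrite cast_ord_id; congr (f _ i); apply: funext => j; by rewrite cast_ord_id.
Qed.

Definition tensr m n q (f : bits m -> bits n) : bits (m + q) -> bits (n + q) :=
  fun x => tcat (f (tfst x)) (tsnd x).
Definition tensl m n p (f : bits m -> bits n) : bits (p + m) -> bits (p + n) :=
  fun x => tcat (tfst x) (f (tsnd x)).
Arguments tensr [m n] q f x.
Arguments tensl [m n] p f x.

Lemma boxgen_tensr m n q (f : bits m -> bits n) : boxgen f -> boxgen (tensr q f).
Proof.
elim=> {m n f} [n|n i eps|n i|n i eps|k m n g f _ IHg _ IHf].
- suff -> : tensr q (fun x : bits n => x) = fun x => x by exact: boxgen_id.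
  by apply: funext => x; rewrite /tensr tcat_fst_snd.
- suff -> : tensr q (face i eps) = face (lshift q i : 'I_(n + q).+1) eps
    by exact: boxgen_face.
  apply: funext => x; apply: funext => j.
  rewrite /tensr /tcat /face /ins /tfst /tsnd.
  case: (@split_ordP n.+1 q j) => [k ->|k ->].
    case: unliftP => [l ->|->].
      case: unliftP => [l' /(congr1 val) /= e|/(congr1 val) /=];
        last by rewrite /bump; lia.
      congr x; apply: val_inj => /=; move: e; rewrite /bump; lia.
    case: unliftP => [l' /(congr1 val) /=|//]; rewrite /bump; lia.
  case: unliftP => [l' /(congr1 val) /= e|/(congr1 val) /=]; last by have := ltn_ord i; lia.
  congr x; apply: val_inj => /=; have := ltn_ord i; move: e; rewrite /bump; lia.
- suff -> : tensr q (degen i) = degen (lshift q i : 'I_(n + q).+1)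
    by exact: boxgen_degen.
  apply: funext => x; apply: funext => j.
  rewrite /tensr /tcat /degen /del /tfst /tsnd.
  case: (@split_ordP n q j) => [k ->|k ->]; congr x; apply: val_inj => //=.
  by have := ltn_ord i; rewrite /bump; lia.
- suff -> : tensr q (conn i eps) = conn (lshift q i : 'I_(n + q).+1) eps
    by exact: boxgen_conn.
  apply: funext => x; apply: funext => j.
  rewrite /tensr /tcat /conn /mrg /del /tfst /tsnd.
  have il := ltn_ord i.
  case: (@split_ordP n.+1 q j) => [k ->|k ->].
    rewrite (_ : (_ == _) = (k == i)); last by rewrite -!val_eqE.
    have e1 : lshift q (lift ord0 i) = lift ord0 (lshift q i : 'I_(n + q).+1) :> 'I_(n + q).+2.
      exact: val_inj.
    rewrite e1.
    have e2 (l : 'I_n.+1) : lshift q (lift (lift ord0 i) l) =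
        lift (lift ord0 (lshift q i : 'I_(n + q).+1)) (lshift q l) :> 'I_(n + q).+2.
      exact: val_inj.
    by rewrite !e2.
  case: ifP => [/eqP /(congr1 val) /=|_]; first lia.
  by congr x; apply: val_inj => /=; rewrite /bump; lia.
- suff -> : tensr q (fun x => g (f x)) = fun x => tensr q g (tensr q f x)
    by exact: boxgen_comp.
  by apply: funext => x; rewrite /tensr tfst_cat tsnd_cat.
Qed.

Lemma boxgen_tensl m n p (f : bits m -> bits n) : boxgen f -> boxgen (tensl p f).
Proof.
elim=> {m n f} [n|n i eps|n i|n i eps|k m n g f _ IHg _ IHf].
- suff -> : tensl p (fun x : bits n => x) = fun x => x by exact: boxgen_id.
  by apply: funext => x; rewrite /tensl tcat_fst_snd.
- have h : p + i < (p + n).+1 by have := ltn_ord i; lia.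
  suff -> : tensl p (face i eps) =
      fun x => tcast (esym (addnS p n)) (face (Ordinal h) eps (tcast erefl x))
    by exact/boxgen_cast/boxgen_face.
  apply: funext => x; apply: funext => j.
  rewrite /tensl /tcat /face /tcast /ins /tfst /tsnd.
  have il := ltn_ord i.
  case: split_ordP => [k ->|k ->].
    have kl := ltn_ord k.
    case: unliftP => [l' /(congr1 val) /= e|/(congr1 val) /=]; last by lia.
    by congr x; apply: val_inj => /=; move: e; rewrite /bump; lia.
  case: unliftP => [l ->|->].
    case: unliftP => [l' /(congr1 val) /= e|/(congr1 val) /=];
      last by rewrite /bump; lia.
    by congr x; apply: val_inj => /=; move: e; rewrite /bump; lia.
  case: unliftP => [l' /(congr1 val) /=|//]; rewrite /bump; lia.
- have h : p + i < (p + n).+1 by have := ltn_ord i; lia.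
  suff -> : tensl p (degen i) =
      fun x => tcast erefl (degen (Ordinal h) (tcast (addnS p n) x))
    by exact/boxgen_cast/boxgen_degen.
  apply: funext => x; apply: funext => j.
  rewrite /tensl /tcat /degen /tcast /del /tfst /tsnd.
  case: split_ordP => [k ->|k ->]; congr x; apply: val_inj => /=; rewrite /bump.
    by have := ltn_ord k; lia.
  lia.
- have h : p + i < (p + n).+1 by have := ltn_ord i; lia.
  have e1 : p + n.+2 = (p + n).+2 by lia.
  suff -> : tensl p (conn i eps) =
      fun x => tcast (esym (addnS p n)) (conn (Ordinal h) eps (tcast e1 x))
    by exact/boxgen_cast/boxgen_conn.
  apply: funext => x; apply: funext => j.
  rewrite /tensl /tcat /conn /tcast /mrg /del /tfst /tsnd.
  have il := ltn_ord i.
  case: split_ordP => [k ->|k ->].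
    have kl := ltn_ord k.
    case: ifP => [/eqP /(congr1 val) /=|_]; first lia.
    by congr x; apply: val_inj => /=; rewrite /bump; lia.
  rewrite (_ : (cast_ord _ _ == _) = (k == i)); last first.
    by rewrite -!val_eqE /= eqn_add2l.
  case: ifP => _; last by congr x; apply: val_inj => /=; rewrite /bump; lia.
  by congr ((if eps then andb else orb) (x _) (x _)); apply: val_inj => /=;
    rewrite /bump; lia.
- suff -> : tensl p (fun x => g (f x)) = fun x => tensl p g (tensl p f x)
    by exact: boxgen_comp.
  by apply: funext => x; rewrite /tensl tfst_cat tsnd_cat.
Qed.

Lemma boxgen_tens m n m' n' (f : bits m -> bits n) (g : bits m' -> bits n') :
  boxgen f -> boxgen g ->
  boxgen (fun x : bits (m + m') => tcat (f (tfst x)) (g (tsnd x))).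
Proof.
move=> fP gP.
suff -> : (fun x : bits (m + m') => tcat (f (tfst x)) (g (tsnd x))) =
    fun x => tensr n' f (tensl m g x).
  by apply: boxgen_comp; [exact: boxgen_tensr|exact: boxgen_tensl].
by apply: funext => x; rewrite /tensr /tensl tfst_cat tsnd_cat.
Qed.

Definition btens m n m' n' (f : box m n) (g : box m' n') :
    box (m + m') (n + n') :=
  Box (boxgen_tens (bfunP f) (bfunP g)).

Lemma boxgen_tcast m n (e : m = n) : boxgen (@tcast bool m n e).
Proof.
have := @boxgen_cast m m m n erefl e _ (boxgen_id m); congr boxgen.
apply: funext => x; congr tcast; apply: funext => i.
by rewrite /tcast cast_ord_id.
Qed.

(* The box category is strictly monoidal, but + is associative and right unital
   only propositionally, so the structural isomorphisms are the identities
   transported along equations in nat. *)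
Definition bcast m n (e : m = n) : box m n := Box (boxgen_tcast e).

Lemma bcast_id n (e : n = n) : bcast e = bid n.
Proof.
by apply: box_eq => x; apply: funext => i; rewrite /= /tcast cast_ord_id.
Qed.

Lemma bcast_comp k m n (e : k = m) (e' : m = n) :
  bcomp (bcast e') (bcast e) = bcast (etrans e e').
Proof. by subst; rewrite !bcast_id bcomp1l. Qed.

Lemma btens_id m n : btens (bid m) (bid n) = bid (m + n).
Proof. by apply: box_eq => x /=; rewrite tcat_fst_snd. Qed.

Lemma btens_comp k m n k' m' n' (g : box m n) (f : box k m) (g' : box m' n')
    (f' : box k' m') :
  btens (bcomp g f) (bcomp g' f') = bcomp (btens g g') (btens f f').
Proof. by apply: box_eq => x /=; rewrite tfst_cat tsnd_cat. Qed.

Lemma btens_cast m n m' n' (e : m = n) (e' : m' = n') (e2 : m + m' = n + n') :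
  btens (bcast e) (bcast e') = bcast e2.
Proof. by subst; rewrite !bcast_id btens_id. Qed.

Definition bassoc m n p : box (m + n + p) (m + (n + p)) :=
  bcast (esym (addnA m n p)).
Definition bassoc_inv m n p : box (m + (n + p)) (m + n + p) :=
  bcast (addnA m n p).
Definition blunit n : box (0 + n) n := bcast (add0n n).
Definition blunit_inv n : box n (0 + n) := bcast (esym (add0n n)).
Definition brunit n : box (n + 0) n := bcast (addn0 n).
Definition brunit_inv n : box n (n + 0) := bcast (esym (addn0 n)).

Lemma bassoc_nat m n p m' n' p' (f : box m m') (g : box n n') (h : box p p') :
  bcomp (bassoc m' n' p') (btens (btens f g) h) =
  bcomp (btens f (btens g h)) (bassoc m n p).
Proof.
apply: box_eq => x /=; apply: funext => i.
rewrite /tcast /tcat.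
have ex (a b : bits m) (c d : 'I_m') : a = b -> c = d -> f a c = f b d by move=> -> ->.
have ey (a b : bits n) (c d : 'I_n') : a = b -> c = d -> g a c = g b d by move=> -> ->.
have ez (a b : bits p) (c d : 'I_p') : a = b -> c = d -> h a c = h b d by move=> -> ->.
case: (split_ordP i) => [j ->|j ->].
  case: split_ordP => [k /(congr1 val) /= e|k /(congr1 val) /= e];
    last by have := ltn_ord j; lia.
  case: split_ordP => [l /(congr1 val) /= e'|l /(congr1 val) /= e'];
    last by have := ltn_ord j; lia.
  apply: ex; last by apply: val_inj => /=; lia.
  by apply: funext => q; rewrite /tfst; congr x; apply: val_inj.
case: (split_ordP j) => [k ->|k ->].
  case: split_ordP => [l /(congr1 val) /= e|l /(congr1 val) /= e];
    last by have := ltn_ord k; lia.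
  case: split_ordP => [r /(congr1 val) /= e'|r /(congr1 val) /= e'];
    first by have := ltn_ord r; lia.
  apply: ey; last by apply: val_inj => /=; lia.
  by apply: funext => q; rewrite /tfst /tsnd; congr x; apply: val_inj.
case: split_ordP => [l /(congr1 val) /= e|l /(congr1 val) /= e].
  by have := ltn_ord l; lia.
apply: ez; last by apply: val_inj => /=; lia.
by apply: funext => q; rewrite /tsnd; congr x; apply: val_inj => /=; lia.
Qed.

Lemma blunit_nat m n (f : box m n) :
  bcomp (blunit n) (btens (bid 0) f) = bcomp f (blunit m).
Proof.
apply: box_eq => x /=; apply: funext => i; rewrite /tcast /tcat.
case: split_ordP => [[]//|k /(congr1 val) /= e].
rewrite (_ : k = i); last exact: val_inj.
by congr (f _ i); apply: funext => j; rewrite /tsnd; congr x; apply: val_inj.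
Qed.

Lemma brunit_nat m n (f : box m n) :
  bcomp (brunit n) (btens f (bid 0)) = bcomp f (brunit m).
Proof.
apply: box_eq => x /=; apply: funext => i; rewrite /tcast /tcat.
case: split_ordP => [k /(congr1 val) /= e|[]//].
rewrite (_ : k = i); last exact: val_inj.
by congr (f _ i); apply: funext => j; rewrite /tfst; congr x; apply: val_inj.
Qed.

Lemma bassocK m n p : bcomp (bassoc_inv m n p) (bassoc m n p) = bid _.
Proof. by rewrite bcast_comp bcast_id. Qed.
Lemma bassoc_invK m n p : bcomp (bassoc m n p) (bassoc_inv m n p) = bid _.
Proof. by rewrite bcast_comp bcast_id. Qed.
Lemma bassoc_inv_nat m n p m' n' p' (f : box m m') (g : box n n') (h : box p p') :
  bcomp (bassoc_inv m' n' p') (btens f (btens g h)) =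
  bcomp (btens (btens f g) h) (bassoc_inv m n p).
Proof.
rewrite -[LHS]bcomp1r -(bassoc_invK m n p) !bcompA; congr bcomp.
by rewrite -bcompA -bassoc_nat bcompA bassocK bcomp1l.
Qed.

Lemma blunitK n : bcomp (blunit_inv n) (blunit n) = bid _.
Proof. by rewrite bcast_comp bcast_id. Qed.
Lemma blunit_invK n : bcomp (blunit n) (blunit_inv n) = bid _.
Proof. by rewrite bcast_comp bcast_id. Qed.
Lemma brunitK n : bcomp (brunit_inv n) (brunit n) = bid _.
Proof. by rewrite bcast_comp bcast_id. Qed.
Lemma brunit_invK n : bcomp (brunit n) (brunit_inv n) = bid _.
Proof. by rewrite bcast_comp bcast_id. Qed.
Lemma blunit_inv_nat m n (f : box m n) :
  bcomp (blunit_inv n) f = bcomp (btens (bid 0) f) (blunit_inv m).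
Proof.
rewrite -[LHS]bcomp1r -(blunit_invK m) !bcompA; congr bcomp.
by rewrite -bcompA -blunit_nat bcompA blunitK bcomp1l.
Qed.
Lemma brunit_inv_nat m n (f : box m n) :
  bcomp (brunit_inv n) f = bcomp (btens f (bid 0)) (brunit_inv m).
Proof.
rewrite -[LHS]bcomp1r -(brunit_invK m) !bcompA; congr bcomp.
by rewrite -bcompA -brunit_nat bcompA brunitK bcomp1l.
Qed.

Lemma btens_castl m n n' (e : n = n') (e' : m + n = m + n') :
  btens (bid m) (bcast e) = bcast e'.
Proof. by rewrite -(bcast_id erefl); exact: btens_cast. Qed.
Lemma btens_castr m n n' (e : n = n') (e' : n + m = n' + m) :
  btens (bcast e) (bid m) = bcast e'.
Proof. by rewrite -(bcast_id erefl); exact: btens_cast. Qed.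
Lemma bcast_irr m n (e e' : m = n) : bcast e = bcast e'.
Proof. by rewrite (eq_irrelevance e e'). Qed.

Lemma bpentagon m n p q :
  bcomp (bassoc m n (p + q)) (bassoc (m + n) p q) =
  bcomp (btens (bid m) (bassoc n p q))
    (bcomp (bassoc m (n + p) q) (btens (bassoc m n p) (bid q))).
Proof.
rewrite /bassoc (btens_castl _ (f_equal (addn m) (esym (addnA n p q)))).
rewrite (btens_castr _ (f_equal (addn^~ q) (esym (addnA m n p)))).
by rewrite !bcast_comp; exact: bcast_irr.
Qed.

Lemma btriangle m n :
  bcomp (btens (bid m) (blunit n)) (bassoc m 0 n) = btens (brunit m) (bid n).
Proof.
rewrite (btens_castl _ (f_equal (addn m) (add0n n))).
rewrite (btens_castr _ (f_equal (addn^~ n) (addn0 m))).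
by rewrite bcast_comp; exact: bcast_irr.
Qed.

Record category : Type := Category {
  ob :> Type;
  hom : ob -> ob -> Type;
  idm : forall a, hom a a;
  compm : forall a b c, hom b c -> hom a b -> hom a c;
  compA : forall a b c d (h : hom c d) (g : hom b c) (f : hom a b),
    compm h (compm g f) = compm (compm h g) f;
  comp1l : forall a b (f : hom a b), compm (idm b) f = f;
  comp1r : forall a b (f : hom a b), compm f (idm a) = f }.
Arguments hom {c0} a b : rename.
Arguments idm {c0} a : rename.
Arguments compm {c0 a b c} g f : rename.

Record functor (C D : category) : Type := Functor {
  fob :> C -> D;
  fmap : forall a b : C, hom a b -> hom (fob a) (fob b);
  fmap_id : forall a, fmap (idm a) = idm (fob a);
  fmap_comp : forall (a b c : C) (g : hom b c) (f : hom a b),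
    fmap (compm g f) = compm (fmap g) (fmap f) }.
Arguments fmap {C D} F {a b} f : rename.

Record monoidal : Type := Monoidal {
  mcat :> category;
  tens : mcat -> mcat -> mcat;
  tensm : forall a b a' b' : mcat,
    hom a b -> hom a' b' -> hom (tens a a') (tens b b');
  munit : mcat;
  assoc : forall a b c : mcat, hom (tens (tens a b) c) (tens a (tens b c));
  assoc_inv : forall a b c : mcat, hom (tens a (tens b c)) (tens (tens a b) c);
  lunit : forall a : mcat, hom (tens munit a) a;
  lunit_inv : forall a : mcat, hom a (tens munit a);
  runit : forall a : mcat, hom (tens a munit) a;
  runit_inv : forall a : mcat, hom a (tens a munit);
  tensm_id : forall a b : mcat, tensm (idm a) (idm b) = idm (tens a b);
  tensm_comp : forall (a b c a' b' c' : mcat) (g : hom b c) (f : hom a b)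
      (g' : hom b' c') (f' : hom a' b'),
    tensm (compm g f) (compm g' f') = compm (tensm g g') (tensm f f');
  assocK : forall a b c, compm (assoc_inv a b c) (assoc a b c) = idm _;
  assoc_invK : forall a b c, compm (assoc a b c) (assoc_inv a b c) = idm _;
  lunitK : forall a, compm (lunit_inv a) (lunit a) = idm _;
  lunit_invK : forall a, compm (lunit a) (lunit_inv a) = idm _;
  runitK : forall a, compm (runit_inv a) (runit a) = idm _;
  runit_invK : forall a, compm (runit a) (runit_inv a) = idm _;
  assoc_nat : forall (a b c a' b' c' : mcat) (f : hom a a') (g : hom b b')
      (h : hom c c'),
    compm (assoc a' b' c') (tensm (tensm f g) h) =
    compm (tensm f (tensm g h)) (assoc a b c);
  lunit_nat : forall (a b : mcat) (f : hom a b),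
    compm (lunit b) (tensm (idm munit) f) = compm f (lunit a);
  runit_nat : forall (a b : mcat) (f : hom a b),
    compm (runit b) (tensm f (idm munit)) = compm f (runit a);
  pentagon : forall a b c d : mcat,
    compm (assoc a b (tens c d)) (assoc (tens a b) c d) =
    compm (tensm (idm a) (assoc b c d))
      (compm (assoc a (tens b c) d) (tensm (assoc a b c) (idm d)));
  triangle : forall a b : mcat,
    compm (tensm (idm a) (lunit b)) (assoc a munit b) =
    tensm (runit a) (idm b) }.
Arguments tens {m} a b : rename.
Arguments tensm {m a b a' b'} f g : rename.
Arguments munit {m} : rename.
Arguments assoc {m} a b c : rename.
Arguments assoc_inv {m} a b c : rename.
Arguments lunit {m} a : rename.
Arguments lunit_inv {m} a : rename.
Arguments runit {m} a : rename.
Arguments runit_inv {m} a : rename.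

Record lax_structure (C D : monoidal) (F : functor C D) : Type := LaxStructure {
  lax_mu : forall a b : C, hom (tens (F a) (F b)) (F (tens a b));
  lax_eta : hom (@munit D) (F (@munit C));
  lax_nat : forall (a a' b b' : C) (f : hom a a') (g : hom b b'),
    compm (lax_mu a' b') (tensm (fmap F f) (fmap F g)) =
    compm (fmap F (tensm f g)) (lax_mu a b);
  lax_assoc : forall a b c : C,
    compm (fmap F (assoc a b c))
      (compm (lax_mu (tens a b) c) (tensm (lax_mu a b) (idm (F c)))) =
    compm (lax_mu a (tens b c))
      (compm (tensm (idm (F a)) (lax_mu b c)) (assoc (F a) (F b) (F c)));
  lax_lunit : forall a : C,
    compm (fmap F (lunit a))
      (compm (lax_mu munit a) (tensm lax_eta (idm (F a)))) = lunit (F a);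
  lax_runit : forall a : C,
    compm (fmap F (runit a))
      (compm (lax_mu a munit) (tensm (idm (F a)) lax_eta)) = runit (F a) }.

Definition lax_monoidal (C D : monoidal) (F : functor C D) : Prop :=
  inhabited (lax_structure F).

Definition box_category : category :=
  @Category nat box bid bcomp bcompA bcomp1l bcomp1r.

Definition box_monoidal : monoidal :=
  @Monoidal box_category addn btens 0 bassoc bassoc_inv blunit blunit_inv
    brunit brunit_inv btens_id btens_comp bassocK bassoc_invK blunitK
    blunit_invK brunitK brunit_invK bassoc_nat blunit_nat brunit_nat
    bpentagon btriangle.

Record cSet : Type := CSet {
  cells :> nat -> Type;
  act : forall m n, cells n -> box m n -> cells m;
  act_id : forall n (x : cells n), act x (bid n) = x;
  act_comp : forall k m n (x : cells n) (g : box m n) (f : box k m),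
    act x (bcomp g f) = act (act x g) f }.
Arguments act {X m n} x f : rename.

Record cmap (X Y : cSet) : Type := CMap {
  cfun :> forall n, X n -> Y n;
  cfun_nat : forall m n (x : X n) (f : box m n),
    cfun (act x f) = act (cfun x) f }.

Lemma cmap_eq (X Y : cSet) (f g : cmap X Y) :
  (forall n (x : X n), f n x = g n x) -> f = g.
Proof.
case: f g => [f fP] [g gP] /= fg.
have e : f = g by apply: functional_extensionality_dep => n; apply: funext.
by subst g; rewrite (Prop_irrelevance fP gP).
Qed.

Definition cmap_id (X : cSet) : cmap X X :=
  @CMap X X (fun n x => x) (fun m n x f => erefl).

Definition cmap_comp (X Y Z : cSet) (g : cmap Y Z) (f : cmap X Y) : cmap X Z.
Proof.
by refine (@CMap X Z (fun n x => g n (f n x)) _) => m n x h; rewrite !cfun_nat.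
Defined.

Definition cSet_category : category.
Proof.
by refine (@Category cSet cmap cmap_id cmap_comp _ _ _) => *; apply: cmap_eq.
Defined.

Definition cube (n : nat) : cSet :=
  @CSet (fun k => box k n) (fun k m f g => bcomp f g) (fun k f => bcomp1r f)
    (fun j k m f g h => bcompA f g h).

Definition quot (T : Type) (R : T -> T -> Prop) : Type :=
  {P : T -> Prop | exists x, P = clos_refl_sym_trans T R x}.

Definition qpi T (R : T -> T -> Prop) (x : T) : quot R :=
  exist _ (clos_refl_sym_trans T R x) (ex_intro _ x erefl).

Definition qrepr T (R : T -> T -> Prop) (q : quot R) : T :=
  projT1 (cid (proj2_sig q)).

Definition qlift T (R : T -> T -> Prop) U (f : T -> U) (q : quot R) : U :=
  f (qrepr q).

Lemma quot_eq T (R : T -> T -> Prop) (p q : quot R) :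
  proj1_sig p = proj1_sig q -> p = q.
Proof.
by case: p q => [P p] [Q q] /= e; subst Q; rewrite (Prop_irrelevance p q).
Qed.

Lemma qpi_eq T (R : T -> T -> Prop) x y : R x y -> qpi R x = qpi R y.
Proof.
move=> xy; apply: quot_eq; apply: funext => z; apply: propext.
split=> h; last by apply: rst_trans h; apply: rst_step.
by apply: rst_trans h; apply: rst_sym; apply: rst_step.
Qed.

Lemma qreprK T (R : T -> T -> Prop) (q : quot R) : qpi R (qrepr q) = q.
Proof. by apply: quot_eq; rewrite /qrepr; case: (cid _) => x /= ->. Qed.

Lemma quot_ind T (R : T -> T -> Prop) (P : quot R -> Prop) :
  (forall x, P (qpi R x)) -> forall q, P q.
Proof. by move=> h q; rewrite -(qreprK q). Qed.

Lemma qliftE T (R : T -> T -> Prop) U (f : T -> U) :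
  (forall x y, R x y -> f x = f y) -> forall x, qlift f (qpi R x) = f x.
Proof.
move=> fR x; rewrite /qlift.
have := congr1 (fun q : quot R => proj1_sig q x) (qreprK (qpi R x)) => /= h.
have {h} : clos_refl_sym_trans T R (qrepr (qpi R x)) x by rewrite h; exact: rst_refl.
by move: (qrepr _) => t; elim=> {t x} // a b c _ -> _ ->.
Qed.

(* (X ⊗ Y)_k is the coend over p and q of X_p * Y_q * box([1]^k, [1]^{p+q}),
   as in the Day convolution formula. *)
Record gpre (X Y : cSet) (k : nat) : Type := GPre {
  gp_p : nat; gp_q : nat;
  gp_x : X gp_p; gp_y : Y gp_q;
  gp_f : box k (gp_p + gp_q) }.
Arguments GPre {X Y k p q} x y f : rename.

Inductive gstep (X Y : cSet) (k : nat) : gpre X Y k -> gpre X Y k -> Prop :=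
  | GStep p q p' q' (x : X p) (y : Y q) (a : box p' p) (b : box q' q)
      (f : box k (p' + q')) :
      gstep (GPre (act x a) (act y b) f) (GPre x y (bcomp (btens a b) f)).

Definition gcell (X Y : cSet) (k : nat) : Type := quot (@gstep X Y k).
Definition gmk (X Y : cSet) k p q (x : X p) (y : Y q) (f : box k (p + q)) :
  gcell X Y k := qpi _ (GPre x y f).

Lemma gmk_act (X Y : cSet) k p q p' q' (x : X p) (y : Y q) (a : box p' p)
    (b : box q' q) (f : box k (p' + q')) :
  gmk (act x a) (act y b) f = gmk x y (bcomp (btens a b) f).
Proof. exact/qpi_eq/GStep. Qed.

Lemma gmk_actl (X Y : cSet) k p q p' (x : X p) (y : Y q) (a : box p' p)
    (f : box k (p' + q)) :
  gmk (act x a) y f = gmk x y (bcomp (btens a (bid q)) f).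
Proof. by rewrite -gmk_act act_id. Qed.

Lemma gmk_actr (X Y : cSet) k p q q' (x : X p) (y : Y q) (b : box q' q)
    (f : box k (p + q')) :
  gmk x (act y b) f = gmk x y (bcomp (btens (bid p) b) f).
Proof. by rewrite -gmk_act act_id. Qed.

Lemma gcell_ind (X Y : cSet) k (P : gcell X Y k -> Prop) :
  (forall p q (x : X p) (y : Y q) f, P (gmk x y f)) -> forall w, P w.
Proof. by move=> h; apply: quot_ind => -[]. Qed.

Definition grec (X Y : cSet) k U
    (F : forall p q, X p -> Y q -> box k (p + q) -> U) (w : gcell X Y k) : U :=
  qlift (fun t => F _ _ (gp_x t) (gp_y t) (gp_f t)) w.

Definition gdinat (X Y : cSet) k U
    (F : forall p q, X p -> Y q -> box k (p + q) -> U) : Prop :=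
  forall p q p' q' (x : X p) (y : Y q) (a : box p' p) (b : box q' q) f,
    F p' q' (act x a) (act y b) f = F p q x y (bcomp (btens a b) f).

Lemma grecE (X Y : cSet) k U
    (F : forall p q, X p -> Y q -> box k (p + q) -> U) : gdinat F ->
  forall p q (x : X p) (y : Y q) f, grec F (gmk x y f) = F p q x y f.
Proof.
move=> Fd p q x y f; rewrite /grec /gmk qliftE // => s t [] *; exact: Fd.
Qed.

Definition gact (X Y : cSet) m n (w : gcell X Y n) (h : box m n) : gcell X Y m :=
  grec (fun p q x y f => gmk x y (bcomp f h)) w.

Lemma gactE (X Y : cSet) m n p q (x : X p) (y : Y q) f (h : box m n) :
  gact (gmk x y f) h = gmk x y (bcomp f h).
Proof. by rewrite /gact grecE // => p1 *; rewrite gmk_act bcompA. Qed.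

Definition gprod (X Y : cSet) : cSet.
Proof.
refine (@CSet (gcell X Y) (@gact X Y) _ _).
- by move=> n; elim/gcell_ind => *; rewrite gactE bcomp1r.
- by move=> k m n w g f; elim/gcell_ind: w => *; rewrite !gactE bcompA.
Defined.

Definition gmap_fun (X Y X' Y' : cSet) (f : cmap X X') (g : cmap Y Y') k
    (w : gcell X Y k) : gcell X' Y' k :=
  grec (fun p q x y h => gmk (f p x) (g q y) h) w.

Lemma gmap_funE (X Y X' Y' : cSet) (f : cmap X X') (g : cmap Y Y') k p q
    (x : X p) (y : Y q) (h : box k (p + q)) :
  gmap_fun f g (gmk x y h) = gmk (f p x) (g q y) h.
Proof. by rewrite /gmap_fun grecE // => p1 *; rewrite !cfun_nat gmk_act. Qed.

Definition gprod_map (X X' Y Y' : cSet) (f : cmap X X') (g : cmap Y Y') :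
  cmap (gprod X Y) (gprod X' Y').
Proof.
refine (@CMap (gprod X Y) (gprod X' Y') (@gmap_fun X Y X' Y' f g) _).
by move=> m n w h; elim/gcell_ind: w => *; rewrite /= gactE !gmap_funE gactE.
Defined.

(* [[x, y, f], z, g] is sent to [x, [y, z, id], a ∘ (f ⊗ id) ∘ g], where a is the
   associator of the box category. *)
Definition gassoc_fun (X Y Z : cSet) k (w : gcell (gprod X Y) Z k) :
    gcell X (gprod Y Z) k :=
  grec (fun d r (v : gprod X Y d) (z : Z r) (g : box k (d + r)) =>
    grec (fun p q x y f =>
      gmk (Y := gprod Y Z) x (gmk y z (bid (q + r)))
        (bcomp (bassoc p q r) (bcomp (btens f (bid r)) g))) v) w.

Lemma gassoc_funE (X Y Z : cSet) k d p q r (x : X p) (y : Y q) (z : Z r)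
    (f : box d (p + q)) (g : box k (d + r)) :
  gassoc_fun (gmk (X := gprod X Y) (gmk x y f) z g) =
  gmk (Y := gprod Y Z) x (gmk y z (bid (q + r)))
    (bcomp (bassoc p q r) (bcomp (btens f (bid r)) g)).
Proof.
have di d' r' (z' : Z r') (g' : box k (d' + r')) :
  gdinat (fun p q (x : X p) (y : Y q) f =>
      gmk (Y := gprod Y Z) x (gmk y z' (bid (q + r')))
        (bcomp (bassoc p q r') (bcomp (btens f (bid r')) g'))).
  move=> p1 q1 p2 q2 x1 y1 a b f1.
  rewrite gmk_actl.
  rewrite gmk_actl bcomp1r.
  have -> : gmk y1 z' (btens b (bid r')) =
      act (X := gprod Y Z) (gmk y1 z' (bid (q1 + r'))) (btens b (bid r')).
    by rewrite /= gactE bcomp1l.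
  rewrite gmk_actr; congr gmk.
  rewrite !bcompA -btens_comp bcomp1l bcomp1r.
  by rewrite -bassoc_nat -!bcompA (bcompA (btens _ _)) -btens_comp bcomp1l.
rewrite /gassoc_fun grecE.
  by rewrite grecE //; exact: di.
move=> d1 r1 d2 r2 v1 z1 a b g1.
elim/gcell_ind: v1 => p1 q1 x1 y1 f1.
rewrite /= gactE !grecE; try exact: di.
rewrite gmk_actr bcomp1r.
have -> : gmk y1 z1 (btens (bid q1) b) =
      act (X := gprod Y Z) (gmk y1 z1 (bid (q1 + r1))) (btens (bid q1) b).
  by rewrite /= gactE bcomp1l.
rewrite gmk_actr; congr gmk.
rewrite bcompA -bassoc_nat btens_id -!bcompA; congr bcomp.
by rewrite !bcompA -!btens_comp !bcomp1l !bcomp1r.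
Qed.

Definition gassoc (X Y Z : cSet) :
  cmap (gprod (gprod X Y) Z) (gprod X (gprod Y Z)).
Proof.
refine (@CMap (gprod (gprod X Y) Z) (gprod X (gprod Y Z))
  (@gassoc_fun X Y Z) _).
move=> m n w h; elim/gcell_ind: w => d r v z g.
elim/gcell_ind: v => p q x y f.
by rewrite /= gactE !gassoc_funE gactE !bcompA.
Defined.

(* [x, [y, z, f], g] is sent to [[x, y, id], z, a^{-1} ∘ (id ⊗ f) ∘ g]. *)
Definition gassoc_inv_fun (X Y Z : cSet) k (w : gcell X (gprod Y Z) k) :
    gcell (gprod X Y) Z k :=
  grec (fun p d (x : X p) (v : gprod Y Z d) (g : box k (p + d)) =>
    grec (fun q r y z f =>
      gmk (X := gprod X Y) (gmk x y (bid (p + q))) z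
        (bcomp (bassoc_inv p q r) (bcomp (btens (bid p) f) g))) v) w.

Lemma gassoc_inv_funE (X Y Z : cSet) k d p q r (x : X p) (y : Y q) (z : Z r)
    (f : box d (q + r)) (g : box k (p + d)) :
  gassoc_inv_fun (gmk (Y := gprod Y Z) x (gmk y z f) g) =
  gmk (X := gprod X Y) (gmk x y (bid (p + q))) z
    (bcomp (bassoc_inv p q r) (bcomp (btens (bid p) f) g)).
Proof.
have di d' p' (x' : X p') (g' : box k (p' + d')) :
  gdinat (fun q r (y : Y q) (z : Z r) f =>
      gmk (X := gprod X Y) (gmk x' y (bid (p' + q))) z
        (bcomp (bassoc_inv p' q r) (bcomp (btens (bid p') f) g'))).
  move=> q1 r1 q2 r2 y1 z1 a b f1.
  rewrite gmk_actr gmk_actr bcomp1r.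
  have -> : gmk x' y1 (btens (bid p') a) =
      act (X := gprod X Y) (gmk x' y1 (bid (p' + q1))) (btens (bid p') a).
    by rewrite /= gactE bcomp1l.
  rewrite gmk_actl; congr gmk.
  rewrite !bcompA -btens_comp bcomp1l bcomp1r.
  by rewrite -bassoc_inv_nat -!bcompA (bcompA (btens _ _)) -btens_comp bcomp1l.
rewrite /gassoc_inv_fun grecE.
  by rewrite grecE //; exact: di.
move=> p1 d1 p2 d2 x1 v1 a b g1.
elim/gcell_ind: v1 => q1 r1 y1 z1 f1.
rewrite /= gactE !grecE; try exact: di.
rewrite gmk_actl bcomp1r.
have -> : gmk x1 y1 (btens a (bid q1)) =
      act (X := gprod X Y) (gmk x1 y1 (bid (p1 + q1))) (btens a (bid q1)).
  by rewrite /= gactE bcomp1l.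
rewrite gmk_actl; congr gmk.
rewrite bcompA -bassoc_inv_nat btens_id -!bcompA; congr bcomp.
by rewrite !bcompA -!btens_comp !bcomp1l !bcomp1r.
Qed.

Definition gassoc_inv (X Y Z : cSet) :
  cmap (gprod X (gprod Y Z)) (gprod (gprod X Y) Z).
Proof.
refine (@CMap (gprod X (gprod Y Z)) (gprod (gprod X Y) Z)
  (@gassoc_inv_fun X Y Z) _).
move=> m n w h; elim/gcell_ind: w => p d x v g.
elim/gcell_ind: v => q r y z f.
by rewrite /= gactE !gassoc_inv_funE gactE !bcompA.
Defined.

Definition glunit_fun (X : cSet) k (w : gcell (cube 0) X k) : X k :=
  grec (X := cube 0) (fun p q (u : box p 0) (x : X q) f =>
    act x (bcomp (blunit q) (bcomp (btens u (bid q)) f))) w.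

Lemma glunit_funE (X : cSet) k p q (u : box p 0) (x : X q) f :
  glunit_fun (k := k) (gmk (X := cube 0) u x f) =
  act x (bcomp (blunit q) (bcomp (btens u (bid q)) f)).
Proof.
rewrite /glunit_fun grecE // => p1 q1 p2 q2 u1 x1 a b f1 /=.
rewrite -act_comp bcompA -blunit_nat -!bcompA; congr (act _ (bcomp _ _)).
by rewrite !bcompA -!btens_comp !bcomp1l !bcomp1r.
Qed.

Definition glunit (X : cSet) : cmap (gprod (cube 0) X) X.
Proof.
refine (@CMap (gprod (cube 0) X) X (@glunit_fun X) _).
move=> m n w h; elim/gcell_ind: w => p q u x f.
by rewrite /= gactE !glunit_funE -act_comp !bcompA.
Defined.

Definition grunit_fun (X : cSet) k (w : gcell X (cube 0) k) : X k :=
  grec (Y := cube 0) (fun p q (x : X p) (u : box q 0) f =>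
    act x (bcomp (brunit p) (bcomp (btens (bid p) u) f))) w.

Lemma grunit_funE (X : cSet) k p q (x : X p) (u : box q 0) f :
  grunit_fun (k := k) (gmk (Y := cube 0) x u f) =
  act x (bcomp (brunit p) (bcomp (btens (bid p) u) f)).
Proof.
rewrite /grunit_fun grecE // => p1 q1 p2 q2 x1 u1 a b f1 /=.
rewrite -act_comp bcompA -brunit_nat -!bcompA; congr (act _ (bcomp _ _)).
by rewrite !bcompA -!btens_comp !bcomp1l !bcomp1r.
Qed.

Definition grunit (X : cSet) : cmap (gprod X (cube 0)) X.
Proof.
refine (@CMap (gprod X (cube 0)) X (@grunit_fun X) _).
move=> m n w h; elim/gcell_ind: w => p q x u f.
by rewrite /= gactE !grunit_funE -act_comp !bcompA.
Defined.

Definition glunit_inv (X : cSet) : cmap X (gprod (cube 0) X).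
Proof.
refine (@CMap X (gprod (cube 0) X)
  (fun k (x : X k) => gmk (X := cube 0) (bid 0 : cube 0 0) x (blunit_inv k)) _).
by move=> m n x f; rewrite /= gactE gmk_actr blunit_inv_nat.
Defined.

Definition grunit_inv (X : cSet) : cmap X (gprod X (cube 0)).
Proof.
refine (@CMap X (gprod X (cube 0))
  (fun k (x : X k) => gmk (Y := cube 0) x (bid 0 : cube 0 0) (brunit_inv k)) _).
by move=> m n x f; rewrite /= gactE gmk_actl brunit_inv_nat.
Defined.

Lemma gassoc_nat (X Y Z X' Y' Z' : cSet) (f : cmap X X') (g : cmap Y Y')
    (h : cmap Z Z') :
  cmap_comp (gassoc X' Y' Z') (gprod_map (gprod_map f g) h) =
  cmap_comp (gprod_map f (gprod_map g h)) (gassoc X Y Z).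
Proof.
apply: cmap_eq => k; elim/gcell_ind => d r v z b; elim/gcell_ind: v => p q x y a.
by rewrite /= gassoc_funE !gmap_funE /= !gmap_funE gassoc_funE.
Qed.

Lemma gassocK (X Y Z : cSet) :
  cmap_comp (gassoc_inv X Y Z) (gassoc X Y Z) = cmap_id _.
Proof.
apply: cmap_eq => k; elim/gcell_ind => d r v z b; elim/gcell_ind: v => p q x y a.
rewrite /= gassoc_funE gassoc_inv_funE btens_id bcomp1l !bcompA bassocK bcomp1l.
have -> : gmk x y a = act (X := gprod X Y) (gmk x y (bid (p + q))) a.
  by rewrite /= gactE bcomp1l.
by rewrite gmk_actl.
Qed.

Lemma gassoc_invK (X Y Z : cSet) :
  cmap_comp (gassoc X Y Z) (gassoc_inv X Y Z) = cmap_id _.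
Proof.
apply: cmap_eq => k; elim/gcell_ind => p d x v b; elim/gcell_ind: v => q r y z a.
rewrite /= gassoc_inv_funE gassoc_funE btens_id bcomp1l !bcompA bassoc_invK bcomp1l.
have -> : gmk y z a = act (X := gprod Y Z) (gmk y z (bid (q + r))) a.
  by rewrite /= gactE bcomp1l.
by rewrite gmk_actr.
Qed.

Lemma glunit_nat (X Y : cSet) (f : cmap X Y) :
  cmap_comp (glunit Y) (gprod_map (cmap_id (cube 0)) f) = cmap_comp f (glunit X).
Proof.
apply: cmap_eq => k; elim/gcell_ind => p q u x a.
by rewrite /= gmap_funE !glunit_funE cfun_nat.
Qed.

Lemma grunit_nat (X Y : cSet) (f : cmap X Y) :
  cmap_comp (grunit Y) (gprod_map f (cmap_id (cube 0))) = cmap_comp f (grunit X).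
Proof.
apply: cmap_eq => k; elim/gcell_ind => p q u x a.
by rewrite /= gmap_funE !grunit_funE cfun_nat.
Qed.

Lemma glunitK (X : cSet) : cmap_comp (glunit_inv X) (glunit X) = cmap_id _.
Proof.
apply: cmap_eq => k; elim/gcell_ind => p q u x a.
rewrite /= glunit_funE gmk_actr.
have {2}-> : u = act (X := cube 0) (bid 0 : cube 0 0) u by rewrite /= bcomp1l.
rewrite gmk_actl; congr gmk.
by rewrite -blunit_inv_nat !bcompA blunitK bcomp1l.
Qed.

Lemma glunit_invK (X : cSet) : cmap_comp (glunit X) (glunit_inv X) = cmap_id _.
Proof.
apply: cmap_eq => k x.
by rewrite /= glunit_funE btens_id bcomp1l blunit_invK act_id.
Qed.

Lemma grunitK (X : cSet) : cmap_comp (grunit_inv X) (grunit X) = cmap_id _.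
Proof.
apply: cmap_eq => k; elim/gcell_ind => p q x u a.
rewrite /= grunit_funE gmk_actl.
have {2}-> : u = act (X := cube 0) (bid 0 : cube 0 0) u by rewrite /= bcomp1l.
rewrite gmk_actr; congr gmk.
by rewrite -brunit_inv_nat !bcompA brunitK bcomp1l.
Qed.

Lemma grunit_invK (X : cSet) : cmap_comp (grunit X) (grunit_inv X) = cmap_id _.
Proof.
apply: cmap_eq => k x.
by rewrite /= grunit_funE btens_id bcomp1l brunit_invK act_id.
Qed.

Lemma gpentagon (W X Y Z : cSet) :
  cmap_comp (gassoc W X (gprod Y Z)) (gassoc (gprod W X) Y Z) =
  cmap_comp (gprod_map (cmap_id W) (gassoc X Y Z))
    (cmap_comp (gassoc W (gprod X Y) Z) (gprod_map (gassoc W X Y) (cmap_id Z))).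
Proof.
apply: cmap_eq => k; elim/gcell_ind => d s v z c.
elim/gcell_ind: v => e r v y b; elim/gcell_ind: v => p q w x a.
rewrite /= gassoc_funE gmap_funE /= gassoc_funE gassoc_funE.
rewrite gassoc_funE gmap_funE /= gassoc_funE.
rewrite btens_id !bcomp1l.
rewrite bcomp1r.
have -> : gmk (Y := gprod Y Z) x (gmk y z (bid (r + s))) (bassoc q r s) =
    act (X := gprod X (gprod Y Z))
      (gmk (Y := gprod Y Z) x (gmk y z (bid (r + s))) (bid (q + (r + s))))
      (bassoc q r s) by rewrite /= gactE bcomp1l.
rewrite gmk_actr; congr gmk.
have -> : btens (bcomp (bassoc p q r) (bcomp (btens a (bid r)) b)) (bid s) =
    bcomp (btens (bassoc p q r) (bid s))
      (bcomp (btens (btens a (bid r)) (bid s)) (btens b (bid s))).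
  by rewrite -!btens_comp !bcomp1l.
rewrite -(btens_id r s) (bcompA (btens a _)) -bassoc_nat !bcompA.
by rewrite bpentagon !bcompA.
Qed.

Lemma gtriangle (X Y : cSet) :
  cmap_comp (gprod_map (cmap_id X) (glunit Y)) (gassoc X (cube 0) Y) =
  gprod_map (grunit X) (cmap_id Y).
Proof.
apply: cmap_eq => k; elim/gcell_ind => d r v y b; elim/gcell_ind: v => p q x u a.
rewrite /= gassoc_funE !gmap_funE /= glunit_funE grunit_funE bcomp1r.
rewrite gmk_actl gmk_actr; congr gmk.
have -> : bcomp (btens (bid p) (bcomp (blunit r) (btens u (bid r))))
    (bcomp (bassoc p q r) (bcomp (btens a (bid r)) b)) =
  bcomp (bcomp (btens (bid p) (blunit r)) (bassoc p 0 r))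
    (bcomp (btens (btens (bid p) u) (bid r)) (bcomp (btens a (bid r)) b)).
  rewrite -(bcompA (btens (bid p) (blunit r))) (bcompA (bassoc p 0 r)) bassoc_nat.
  by rewrite !bcompA -!btens_comp bcomp1l.
by rewrite btriangle !bcompA -!btens_comp !bcomp1l.
Qed.

Lemma gprod_map_id (X Y : cSet) :
  gprod_map (cmap_id X) (cmap_id Y) = cmap_id (gprod X Y).
Proof. by apply: cmap_eq => k; elim/gcell_ind => *; rewrite /= gmap_funE. Qed.

Lemma gprod_map_comp (X Y Z X' Y' Z' : cSet) (g : cmap Y Z) (f : cmap X Y)
    (g' : cmap Y' Z') (f' : cmap X' Y') :
  gprod_map (cmap_comp g f) (cmap_comp g' f') =
  cmap_comp (gprod_map g g') (gprod_map f f').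
Proof. by apply: cmap_eq => k; elim/gcell_ind => *; rewrite /= !gmap_funE. Qed.

Definition cSet_monoidal : monoidal :=
  @Monoidal cSet_category gprod gprod_map (cube 0) gassoc gassoc_inv glunit
    glunit_inv grunit grunit_inv gprod_map_id gprod_map_comp gassocK gassoc_invK
    glunitK glunit_invK grunitK grunit_invK gassoc_nat glunit_nat grunit_nat
    gpentagon gtriangle.

(* The geometric product extends the monoidal product of the box category along
   the Yoneda embedding. *)
Definition cube_gprod (m n : nat) : cmap (gprod (cube m) (cube n)) (cube (m + n)).
Proof.
refine (@CMap (gprod (cube m) (cube n)) (cube (m + n)) (fun k w =>
  grec (X := cube m) (Y := cube n)
    (fun p q (u : box p m) (v : box q n) f => bcomp (btens u v) f) w) _).
move=> k l w h; elim/gcell_ind: w => p q u v f.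
rewrite /= gactE !grecE /=; try by move=> ? *; rewrite /= btens_comp bcompA.
by rewrite bcompA.
Defined.

Definition cube_gprod_inv (m n : nat) :
  cmap (cube (m + n)) (gprod (cube m) (cube n)).
Proof.
refine (@CMap (cube (m + n)) (gprod (cube m) (cube n)) (fun k h =>
  gmk (X := cube m) (Y := cube n) (bid m : cube m m) (bid n : cube n n) h) _).
by move=> k l f h; rewrite /= gactE.
Defined.

Lemma cube_gprodK m n : cmap_comp (cube_gprod_inv m n) (cube_gprod m n) = cmap_id _.
Proof.
apply: cmap_eq => k; elim/gcell_ind => p q u v f.
rewrite /= grecE; last by move=> ? *; rewrite /= btens_comp bcompA.
by rewrite -(gmk_act (X := cube m) (Y := cube n)) /= !bcomp1l.
Qed.

Lemma cube_gprod_invK m n :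
  cmap_comp (cube_gprod m n) (cube_gprod_inv m n) = cmap_id _.
Proof.
apply: cmap_eq => k f.
rewrite /= grecE; last by move=> ? *; rewrite /= btens_comp bcompA.
by rewrite btens_id bcomp1l.
Qed.

Record graph : Type := Graph {
  vert :> Type;
  edge : vert -> vert -> Prop;
  edge_sym : forall v w, edge v w -> edge w v;
  edge_irr : forall v, ~ edge v v }.
Arguments edge {g} v w : rename.

Definition sim (G : graph) (v w : G) : Prop := v = w \/ edge v w.

Record gmap (G H : graph) : Type := GMap {
  gfun :> G -> H;
  gfunP : forall v w, sim v w -> sim (gfun v) (gfun w) }.

Lemma gmap_eq (G H : graph) (f g : gmap G H) : (forall v, f v = g v) -> f = g.
Proof.
case: f g => [f fP] [g gP] /= fg.
have e : f = g by apply: funext.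
by subst g; rewrite (Prop_irrelevance fP gP).
Qed.

Definition gmap_id (G : graph) : gmap G G := @GMap G G id (fun v w h => h).

Definition gmap_comp (G H K : graph) (g : gmap H K) (f : gmap G H) : gmap G K :=
  @GMap G K (fun v => g (f v)) (fun v w h => gfunP g (gfunP f h)).

Definition graph_category : category.
Proof.
by refine (@Category graph gmap gmap_id gmap_comp _ _ _) => *; apply: gmap_eq.
Defined.

Definition gtens (G H : graph) : graph.
Proof.
refine (@Graph (G * H)%type (fun a b => (a.1 = b.1 /\ edge a.2 b.2) \/
  (a.2 = b.2 /\ edge a.1 b.1)) _ _).
- by move=> a b [[-> /edge_sym]|[-> /edge_sym]]; [left|right].
- by move=> a [[_ /edge_irr]|[_ /edge_irr]].
Defined.

Lemma gtens_simE (G H : graph) (a b : gtens G H) :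
  sim a b <-> (a.1 = b.1 /\ sim a.2 b.2) \/ (a.2 = b.2 /\ sim a.1 b.1).
Proof.
case: a b => [v w] [v' w'] /=; split.
  by case=> [[-> ->]|[[/= -> h]|[/= -> h]]];
    [left; split=> //; left|left; split=> //; right|right; split=> //; right].
by case=> [[-> [->|h]]|[-> [->|h]]];
  [left|right; left|left|right; right].
Qed.

Definition gtens_map (G H G' H' : graph) (f : gmap G H) (g : gmap G' H') :
  gmap (gtens G G') (gtens H H').
Proof.
refine (@GMap (gtens G G') (gtens H H') (fun a => (f a.1, g a.2)) _).
move=> a b /gtens_simE [] [e h]; apply/gtens_simE; [left|right];
  by rewrite /= e; split=> //; exact: gfunP.
Defined.

Definition path_graph (m : nat) : graph.
Proof.
refine (@Graph 'I_m.+1 (fun i j => i.+1 = j :> nat \/ j.+1 = i :> nat) _ _).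
- by move=> i j []; [right|left].
- by move=> i; lia.
Defined.

Definition line_graph : graph.
Proof.
refine (@Graph int (fun i j => i + 1 = j \/ j + 1 = i)%R _ _).
- by move=> i j []; [right|left].
- by move=> i; lia.
Defined.

Definition gtens_assoc (G H K : graph) :
  gmap (gtens (gtens G H) K) (gtens G (gtens H K)).
Proof.
refine (@GMap (gtens (gtens G H) K) (gtens G (gtens H K))
  (fun a => (a.1.1, (a.1.2, a.2))) _).
move=> [[u v] w] [[u' v'] w'] /gtens_simE /= [[[-> ->] h]|[-> /gtens_simE /= h]];
  apply/gtens_simE => /=; first by left; split=> //; apply/gtens_simE; left.
by case: h => -[-> h]; [left|right]; split=> //; apply/gtens_simE; right.
Defined.

Definition gtens_assoc_inv (G H K : graph) :
  gmap (gtens G (gtens H K)) (gtens (gtens G H) K).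
Proof.
refine (@GMap (gtens G (gtens H K)) (gtens (gtens G H) K)
  (fun a => ((a.1, a.2.1), a.2.2)) _).
move=> [u [v w]] [u' [v' w']] /gtens_simE /= [[-> /gtens_simE /= h]|[[-> ->] h]];
  apply/gtens_simE => /=; last by right; split=> //; apply/gtens_simE; right.
by case: h => -[-> h]; [left|right]; split=> //; apply/gtens_simE; left.
Defined.

Definition gtens_lunit (G : graph) : gmap (gtens (path_graph 0) G) G.
Proof.
refine (@GMap (gtens (path_graph 0) G) G (fun a => a.2) _).
by move=> a b /gtens_simE [[_ //]|[-> _]]; left.
Defined.

Definition gtens_lunit_inv (G : graph) : gmap G (gtens (path_graph 0) G).
Proof.
refine (@GMap G (gtens (path_graph 0) G) (fun v => (ord0, v)) _).
by move=> v w h; apply/gtens_simE; left.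
Defined.

Definition gtens_runit (G : graph) : gmap (gtens G (path_graph 0)) G.
Proof.
refine (@GMap (gtens G (path_graph 0)) G (fun a => a.1) _).
by move=> a b /gtens_simE [[-> _]|[_ //]]; left.
Defined.

Definition gtens_runit_inv (G : graph) : gmap G (gtens G (path_graph 0)).
Proof.
refine (@GMap G (gtens G (path_graph 0)) (fun v => (v, ord0)) _).
by move=> v w h; apply/gtens_simE; right.
Defined.

Definition graph_monoidal : monoidal.
Proof.
refine (@Monoidal graph_category gtens gtens_map (path_graph 0) gtens_assoc
  gtens_assoc_inv gtens_lunit gtens_lunit_inv gtens_runit gtens_runit_inv
  _ _ _ _ _ _ _ _ _ _ _ _ _).
all: move=> *; apply: gmap_eq => /=.
- by case.
- by [].
- by case=> [[u v] w].
- by case=> u [v w].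
- by case=> i v; rewrite [i]ord1.
- by [].
- by case=> v i; rewrite [i]ord1.
- by [].
all: by case; try case.
Defined.

(* The n-fold tensor power of G, with tuples instead of nested pairs as vertices;
   gpow0 and gpowS_sim identify it with the iterated product. *)
Definition gpow (G : graph) (n : nat) : graph.
Proof.
refine (@Graph (tup G n)
  (fun v w => exists i, edge (v i) (w i) /\ forall j, j <> i -> v j = w j) _ _).
- by move=> v w [i [h hj]]; exists i; split=> [|j /hj //]; exact: edge_sym.
- by move=> v [i [/edge_irr]].
Defined.

Lemma gpow0 (G : graph) (v w : gpow G 0) : v = w.
Proof. by apply: funext; case. Qed.

Lemma gpowS_sim (G : graph) n (v w : gpow G n.+1) :
  sim v w <-> @sim (gtens G (gpow G n)) (v ord0, del ord0 v) (w ord0, del ord0 w).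
Proof.
have E (a b : tup G n.+1) : a ord0 = b ord0 -> del ord0 a = del ord0 b -> a = b.
  move=> e0 eS; apply: funext => i.
  case: (unliftP ord0 i) => [j|] -> //; exact: (congr1 (@^~ j) eS).
split=> [[->|[i [h hj]]]|]; first by left.
  apply/gtens_simE => /=; case: (unliftP ord0 i) => [k|] ei; subst i.
    left; split; first exact: hj.
    by right; exists k; split=> // j /eqP jk; apply: hj; apply/eqP; rewrite (inj_eq lift_inj).
  right; split; last by right.
  by apply: funext => j; apply: hj.
move=> /gtens_simE /= [[e0 [eS|[i [h hj]]]]|[eS [e0|h]]].
- by left; apply: E.
- right; exists (lift ord0 i); split=> // j.
  case: (unliftP ord0 j) => [k|] -> // /eqP; rewrite (inj_eq lift_inj) => /eqP; exact: hj.
- by left; apply: E.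
- right; exists ord0; split=> // j.
  by case: (unliftP ord0 j) => [k|] -> // _; exact: (congr1 (@^~ k) eS).
Qed.

(* A monotone map phi : [1]^k -> [1]^n is extended to {0, ..., N}^k by applying it to
   all the threshold vectors (t < v_1, ..., t < v_k): coordinatewise, the value is
   the number of t < N such that phi sends the t-th threshold vector to 1.  On
   constants, coordinates, maxima and minima this gives constants 0 or N,
   coordinates, maxima and minima, and it is compatible with composition; see
   pathmap_face, pathmap_degen, pathmap_conn and nerve_act_face, nerve_act_degen,
   nerve_act_conn below. *)
Definition thr (N : nat) k n (phi : bits k -> bits n) (v : tup nat k) : tup nat n :=
  fun j => \sum_(t < N) phi (fun i => t < v i) j.

Definition monob k n (phi : bits k -> bits n) : Prop :=
  forall x y : bits k, (forall i, x i -> y i) -> forall j, phi x j -> phi y j.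

Lemma box_mono k n (phi : bits k -> bits n) : boxgen phi -> monob phi.
Proof.
elim=> {k n phi} [n|n i eps|n i|n i eps|k m n g f _ IHg _ IHf] x y xy j.
- exact: xy.
- by rewrite /face /ins; case: unlift => // a; exact: xy.
- exact: xy.
- rewrite /conn /mrg /del; case: ifP => _; last exact: xy.
  case: eps; first by move=> /andP[/xy -> /xy ->].
  by move=> /orP[/xy ->|/xy ->] //; rewrite orbT.
- by apply: IHg => a; exact: IHf.
Qed.

(* Changing one coordinate of the argument changes at most one coordinate. *)
Definition nonexpb k n (phi : bits k -> bits n) : Prop :=
  forall x y : bits k, (forall i i', x i <> y i -> x i' <> y i' -> i = i') ->
  forall j j', phi x j <> phi y j -> phi x j' <> phi y j' -> j = j'.

Lemma nonexpb_dep k n (phi : bits k -> bits n) (g : 'I_k -> option 'I_n) :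
  (forall x y j, (forall i, g i = Some j -> x i = y i) -> phi x j = phi y j) ->
  nonexpb phi.
Proof.
move=> gP x y xy.
have D j : phi x j <> phi y j -> exists2 i, g i = Some j & x i <> y i.
  move=> ne; apply: contrapT => h; apply: ne; apply: gP => i gi.
  by apply: contrapT => ne; apply: h; exists i.
move=> j j' /D [i gi ni] /D [i' gi' ni'].
have e := xy _ _ ni ni'; subst i'.
by move: gi'; rewrite gi => -[].
Qed.

Lemma box_nonexp k n (phi : bits k -> bits n) : boxgen phi -> nonexpb phi.
Proof.
elim=> {k n phi} [n|n i eps|n i|n i eps|k m n g f _ IHg _ IHf].
- by move=> x y; apply.
- apply: (@nonexpb_dep _ _ _ (fun k => Some (lift i k))) => x y j h.
  rewrite /face /ins; case: unliftP => // k ej; apply: h; by rewrite ej.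
- apply: (@nonexpb_dep _ _ _ (fun k => unlift i k)) => x y j h.
  by apply: h; rewrite liftK.
- apply: (@nonexpb_dep _ _ _
    (fun k => Some (if unlift (lift ord0 i) k is Some l then l else i))) => x y j h.
  rewrite /conn /mrg /del; case: eqP => [e|_]; last by apply: h; rewrite liftK.
  by congr ((if eps then andb else orb) _ _); apply: h;
    rewrite ?liftK ?unlift_none ?e.
- by move=> x y xy; apply: IHg; exact: IHf.
Qed.

Lemma sum_antitone N (P : nat -> bool) :
  (forall s t, s <= t -> P t -> P s) ->
  forall t, t < N -> (t < \sum_(s < N) P s) = P t.
Proof.
move=> Pm; elim: N => [//|N IH] t tN.
rewrite big_ord_recr /=.
have le1 : \sum_(s < N) P s <= N.
  rewrite -[X in _ <= X]card_ord -sum1_card; apply: leq_sum => i _; exact: leq_b1.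
case PN: (P N).
  have -> : \sum_(s < N) P s = N.
    rewrite -[RHS]card_ord -sum1_card; apply: eq_bigr => i _.
    by rewrite (Pm i N) // ltnW.
  by rewrite addn1 tN (Pm t N).
rewrite addn0; move: tN; rewrite ltnS leq_eqVlt => /orP[/eqP ->|]; last exact: IH.
by rewrite PN; apply/negbTE; rewrite -leqNgt.
Qed.

Lemma thr_le N k n (phi : bits k -> bits n) v j : thr N phi v j <= N.
Proof.
rewrite /thr -[X in _ <= X]card_ord -sum1_card; apply: leq_sum => i _; exact: leq_b1.
Qed.

Lemma thr_lt N k n (phi : bits k -> bits n) v j t : monob phi -> t < N ->
  (t < thr N phi v j) = phi (fun i => t < v i) j.
Proof.
move=> m tN; rewrite /thr (sum_antitone (P := fun t => phi (fun i => t < v i) j)) //.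
by move=> s u su; apply: m => i; exact: leq_ltn_trans.
Qed.

Lemma thr_eq N a b : a <= N -> b <= N ->
  (forall t, t < N -> (t < a) = (t < b)) -> a = b.
Proof.
move=> aN bN h; apply/eqP; rewrite eqn_leq; apply/andP; split.
  by rewrite leqNgt; apply/negP => lt; have := h b (leq_trans lt aN); rewrite lt ltnn.
by rewrite leqNgt; apply/negP => lt; have := h a (leq_trans lt bN); rewrite lt ltnn.
Qed.

Lemma thr_comp N k m n (psi : bits m -> bits n) (phi : bits k -> bits m) v :
  monob phi -> thr N (fun x => psi (phi x)) v = thr N psi (thr N phi v).
Proof.
move=> mphi; apply: funext => j; rewrite /thr; apply: eq_bigr => t _.
by congr (nat_of_bool (psi _ j)); apply: funext => i; rewrite -/(thr N phi v i) thr_lt.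
Qed.

Lemma thr_id N n (v : tup nat n) j : thr N (fun x : bits n => x) v j = minn N (v j).
Proof.
apply: (@thr_eq N); first exact: thr_le; first exact: geq_minl.
have mid : monob (fun x : bits n => x) by move=> x y; apply.
by move=> t tN; rewrite (thr_lt _ _ mid tN) leq_min tN.
Qed.

Lemma thr_congr N k n (phi : bits k -> bits n) (v w : tup nat k) :
  (forall i t, t < N -> (t < v i) = (t < w i)) -> thr N phi v = thr N phi w.
Proof.
move=> h; apply: funext => j; rewrite /thr; apply: eq_bigr => t _.
by congr (nat_of_bool (phi _ j)); apply: funext => i; exact: h.
Qed.

Lemma thr_step N k n (phi : bits k -> bits n) (v w : tup nat k) i :
  boxgen phi -> w i = (v i).+1 -> (forall j, j <> i -> v j = w j) ->
  thr N phi v = thr N phi w \/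
  exists j, thr N phi w j = (thr N phi v j).+1 /\
    forall j', j' <> j -> thr N phi v j' = thr N phi w j'.
Proof.
move=> phiP ei ej.
have T t : t <> v i -> (fun j => t < v j) = (fun j => t < w j).
  move=> ti; apply: funext => j; have [->|/eqP/ej -> //] := eqVneq j i.
  by rewrite ei; lia.
have [Nv|vN] := leqP N (v i).
  left; apply: thr_congr => j t tN; have tv : t <> v i by lia.
  exact: (congr1 (@^~ j) (T _ tv)).
pose b : bits k := fun j => v i < v j; pose c : bits k := fun j => v i < w j.
have D j : phi b j = phi c j -> thr N phi v j = thr N phi w j.
  move=> bc; rewrite /thr; apply: eq_bigr => t _.
  have [->|/eqP tv] := eqVneq (t : nat) (v i); first by rewrite -/b -/c bc.
  by rewrite T.
have [all|nall] := pselect (forall j, phi b j = phi c j).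
  by left; apply: funext => j; exact: D.
have [j nej] : exists j, phi b j <> phi c j.
  by apply: contrapT => h; apply: nall => j; apply: contrapT => ne; apply: h; exists j.
right; exists j; split; last first.
  move=> j' jj'; apply: D; apply: contrapT => ne'; apply: jj'.
  have bc l l' : b l <> c l -> b l' <> c l' -> l = l'.
    have E a : b a <> c a -> a = i.
      by move=> ne; apply: contrapT => /ej e; apply: ne; rewrite /b /c e.
    by move=> /E -> /E ->.
  exact: (box_nonexp phiP bc).
have le : forall a, b a -> c a.
  move=> a; rewrite /b /c; have [->|/eqP/ej -> //] := eqVneq a i; by rewrite ltnn.
have [bj cj] : phi b j = false /\ phi c j = true.
  have := box_mono phiP le (j := j); move: nej; case: (phi b j); case: (phi c j) => //.
  by move=> _ /(_ isT).
rewrite /thr (bigD1 (Ordinal vN)) //= [in RHS](bigD1 (Ordinal vN)) //=.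
rewrite -/b -/c bj cj add0n add1n; congr _.+1; apply: eq_bigr => t tv.
by rewrite T // => e; move/eqP: tv; apply; exact: val_inj.
Qed.

Definition pathmap_fun m k n (phi : box k n) (v : gpow (path_graph m) k) :
    gpow (path_graph m) n :=
  fun j => inord (thr m phi (fun i => v i : nat) j).

Lemma pathmap_val m k n (phi : box k n) v j :
  pathmap_fun (m := m) phi v j = thr m phi (fun i => v i : nat) j :> nat.
Proof. by rewrite /pathmap_fun inordK // ltnS thr_le. Qed.

Lemma gpow_sym (G : graph) n (v w : gpow G n) : sim v w -> sim w v.
Proof. by case=> [->|/edge_sym]; [left|right]. Qed.

Definition pathmap m k n (phi : box k n) :
  gmap (gpow (path_graph m) k) (gpow (path_graph m) n).
Proof.
refine (@GMap (gpow (path_graph m) k) (gpow (path_graph m) n)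
  (@pathmap_fun m k n phi) _).
have H (v w : gpow (path_graph m) k) i : w i = (v i).+1 :> nat ->
    (forall j, j <> i -> v j = w j) ->
    @sim (gpow (path_graph m) n) (pathmap_fun phi v) (pathmap_fun phi w).
  move=> ei ej.
  have [|e|[j [h hj]]] := @thr_step m k n phi (fun a => v a : nat)
    (fun a => w a : nat) i (bfunP phi) ei.
  - by move=> j /ej ->.
  - by left; apply: funext => j; apply: val_inj; rewrite /= !pathmap_val e.
  - right; exists j; split; first by left; rewrite /= !pathmap_val h.
    by move=> j' /hj e; apply: val_inj; rewrite /= !pathmap_val.
move=> v w [->|[i [[e|e] ej]]]; first by left.
  exact: (H _ _ i).
by apply: gpow_sym; apply: (H _ _ i) => // j /ej.
Defined.

Lemma pathmap_id m n : pathmap m (bid n) = gmap_id _.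
Proof.
apply: gmap_eq => v; apply: funext => j; apply: val_inj => /=.
by rewrite pathmap_val thr_id; apply/minn_idPr; rewrite -ltnS.
Qed.

Lemma pathmap_comp m k l n (g : box l n) (f : box k l) :
  pathmap m (bcomp g f) = gmap_comp (pathmap m g) (pathmap m f).
Proof.
apply: gmap_eq => v; apply: funext => j; apply: val_inj => /=.
rewrite !pathmap_val (thr_comp _ _ _ (box_mono (bfunP f))).
by congr thr; apply: funext => i; rewrite pathmap_val.
Qed.

Lemma pathmap_face m n (i : 'I_n.+1) eps (v : gpow (path_graph m) n) :
  pathmap m (bface i eps) v = ins i (if eps then ord_max else ord0) v.
Proof.
apply: funext => j; apply: val_inj; rewrite /= pathmap_val.
apply: (@thr_eq m); [exact: thr_le| by rewrite -ltnS | move=> t tm].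
rewrite (thr_lt _ _ (box_mono (boxgen_face _ _)) tm).
rewrite /face /ins; case: unlift => //; by case: eps => /=; rewrite ?tm.
Qed.

Lemma pathmap_degen m n (i : 'I_n.+1) (v : gpow (path_graph m) n.+1) :
  pathmap m (bdegen i) v = del i v.
Proof.
apply: funext => j; apply: val_inj; rewrite /= pathmap_val.
apply: (@thr_eq m); [exact: thr_le| by rewrite -ltnS | move=> t tm].
by rewrite (thr_lt _ _ (box_mono (boxgen_degen _)) tm).
Qed.

Lemma pathmap_conn m n (i : 'I_n.+1) eps (v : gpow (path_graph m) n.+2) j :
  pathmap m (bconn i eps) v j =
    mrg (if eps then minn else maxn) i (fun l => v l : nat) j :> nat.
Proof.
rewrite /= pathmap_val; have vm l : (v l : nat) <= m by rewrite -ltnS.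
apply: (@thr_eq m); first exact: thr_le.
  rewrite /mrg /del; case: ifP => // _.
  by case: eps; rewrite ?geq_max ?geq_min !vm.
move=> t tm; rewrite (thr_lt _ _ (box_mono (boxgen_conn _ _)) tm).
rewrite /conn /mrg /del; case: ifP => // _.
by case: eps; rewrite ?leq_max ?leq_min.
Qed.

Definition nerve_m_ob (m : nat) (G : graph) : cSet.
Proof.
refine (@CSet (fun n => gmap (gpow (path_graph m) n) G)
  (fun k n f phi => gmap_comp f (pathmap m phi)) _ _).
- by move=> n f; rewrite pathmap_id; exact: gmap_eq.
- by move=> k l n f g h; rewrite pathmap_comp; exact: gmap_eq.
Defined.

Definition nerve_m_map (m : nat) (G H : graph) (h : gmap G H) :
    cmap (nerve_m_ob m G) (nerve_m_ob m H) :=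
  @CMap (nerve_m_ob m G) (nerve_m_ob m H) (fun n f => gmap_comp h f)
    (fun k n f phi => erefl).

Definition nerve_m (m : nat) : functor graph_monoidal cSet_monoidal.
Proof.
by refine (@Functor graph_monoidal cSet_monoidal (nerve_m_ob m)
  (@nerve_m_map m) _ _) => *; apply: cmap_eq => n f; exact: gmap_eq.
Defined.

Definition upd (A : Type) n (v : tup A n) (i : 'I_n) (a : A) : tup A n :=
  fun j => if j == i then a else v j.

Definition stable (T : Type) n (M : nat) (f : tup int n -> T) : Prop :=
  forall (i : 'I_n) (v : tup int n),
    ((M%:Z < v i)%R -> f (upd v i M%:Z%R) = f v) /\
    ((v i < - M%:Z)%R -> f (upd v i (- M%:Z)%R) = f v).

Record scell (G : graph) (n : nat) : Type := SCell {
  sfun :> gmap (gpow line_graph n) G;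
  sfunP : exists M : nat, stable M sfun }.

Definition sbound (G : graph) n (f : scell G n) : nat := projT1 (cid (sfunP f)).

Lemma sboundP (G : graph) n (f : scell G n) : stable (sbound f) f.
Proof. exact: projT2 (cid (sfunP f)). Qed.

Lemma scell_eq (G : graph) n (f g : scell G n) : (forall v, f v = g v) -> f = g.
Proof.
case: f g => [f fP] [g gP] /= fg.
have e : f = g by apply: gmap_eq.
by subst g; rewrite (Prop_irrelevance fP gP).
Qed.

Definition zpos (z : int) : nat := if z is Posz n then n else 0.

(* The extension of phi to {-M, ..., M}^k, precomposed with the coordinatewise
   truncation of Z^k to that grid. *)
Definition linemap_fun (M : nat) k n (phi : bits k -> bits n)
    (v : gpow line_graph k) : gpow line_graph n :=
  fun j => (Posz (thr (2 * M) phi (fun i => zpos (v i + M%:Z)%R) j) - M%:Z)%R.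

Definition trunc (M : nat) (z : int) : int :=
  (Posz (minn (2 * M) (zpos (z + M%:Z)%R)) - M%:Z)%R.

Lemma truncE M z : trunc M z =
  if (M%:Z < z)%R then M%:Z%R else if (z < - M%:Z)%R then (- M%:Z)%R else z.
Proof.
rewrite /trunc /zpos.
case e: (z + M%:Z)%R => [a|a]; rewrite ?NegzE in e;
  case: ifP => h1; try (case: ifP => h2); lia.
Qed.

Lemma stable_trunc (T : Type) n M (f : tup int n -> T) : stable M f ->
  forall v, f (fun i => trunc M (v i)) = f v.
Proof.
move=> st v.
have H l : l <= n -> f (fun i => if i < l then trunc M (v i) else v i) = f v.
  elim: l => [|l IH] ln; first by congr f; apply: funext.
  rewrite -(IH (ltnW ln)); set w := (X in _ = f X).
  have -> : (fun i : 'I_n => if i < l.+1 then trunc M (v i) else v i) =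
      upd w (Ordinal ln) (trunc M (w (Ordinal ln))).
    apply: funext => i; rewrite /upd -val_eqE /= /w /= ltnn ltnS leq_eqVlt.
    by case: eqP => [e|//] /=; congr (trunc M (v _)); exact: val_inj.
  have [h1 h2] := st (Ordinal ln) w.
  rewrite truncE; case: ifP => [/h1 //|_]; case: ifP => [/h2 //|_].
  by congr f; apply: funext => i; rewrite /upd; case: eqP => // ->.
by rewrite -(H n (leqnn n)); congr f; apply: funext => i; rewrite ltn_ord.
Qed.

Lemma linemap_trunc M M' k n (phi : bits k -> bits n) v j : monob phi ->
  M <= M' -> linemap_fun M phi v j = trunc M (linemap_fun M' phi v j).
Proof.
move=> mphi MM'; rewrite /linemap_fun /trunc; congr (Posz _ - _)%R.
apply: (@thr_eq (2 * M)); [exact: thr_le|exact: geq_minl|move=> t tM].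
rewrite thr_lt // leq_min tM /=.
have Z z s : (s < zpos z) = (Posz s < z)%R by case: z => a /=; lia.
rewrite Z.
have -> : (Posz t < Posz (thr (2 * M') phi (fun i => zpos (v i + M'%:Z)%R) j)
   - M'%:Z + M%:Z)%R = (t + (M' - M) < thr (2 * M') phi (fun i => zpos (v i + M'%:Z)%R) j)
  by lia.
rewrite thr_lt //; last by lia.
by congr (phi _ j); apply: funext => i; rewrite !Z; lia.
Qed.

Lemma stable_linemap (G : graph) M M' k n (phi : bits k -> bits n)
    (f : gpow line_graph n -> G) v : monob phi -> stable M f -> stable M' f ->
  f (linemap_fun M phi v) = f (linemap_fun M' phi v).
Proof.
move=> mphi; wlog MM' : M M' / M <= M'.
  move=> H sM sM'; have [/H|/ltnW/H] := leqP M M'; first exact.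
  by move=> h; rewrite h.
move=> sM _; rewrite -(stable_trunc sM (linemap_fun M' phi v)).
by congr f; apply: funext => j; exact: linemap_trunc.
Qed.

Definition linemap (M : nat) k n (phi : box k n) :
  gmap (gpow line_graph k) (gpow line_graph n).
Proof.
refine (@GMap (gpow line_graph k) (gpow line_graph n)
  (@linemap_fun M k n phi) _).
have H (v w : gpow line_graph k) i : (v i + 1)%R = w i ->
    (forall j, j <> i -> v j = w j) ->
    @sim (gpow line_graph n) (linemap_fun M phi v) (linemap_fun M phi w).
  move=> ei ej; rewrite /linemap_fun.
  have [e|/eqP ne] := eqVneq (zpos (v i + M%:Z)%R) (zpos (w i + M%:Z)%R).
    left; apply: funext => j; congr (Posz (thr _ _ _ j) - _)%R.
    by apply: funext => a; have [->|/eqP/ej -> //] := eqVneq a i.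
  have e : zpos (w i + M%:Z)%R = (zpos (v i + M%:Z)%R).+1.
    move: ne; rewrite -ei /zpos.
    case ea: (v i + M%:Z)%R => [a|a]; rewrite ?NegzE in ea;
    case eb: (v i + 1 + M%:Z)%R => [b|b]; rewrite ?NegzE in eb; lia.
  have [|{}e|[j [h hj]]] := @thr_step (2 * M) k n phi
    (fun a => zpos (v a + M%:Z)%R) (fun a => zpos (w a + M%:Z)%R) i (bfunP phi) e.
  - by move=> j /ej ->.
  - by left; rewrite e.
  - right; exists j; split; first by left; rewrite h /=; lia.
    by move=> j' /hj ->.
move=> v w [->|[i [[e|e] ej]]]; first by left.
  exact: (H _ _ i).
by apply: gpow_sym; apply: (H _ _ i) => // j /ej.
Defined.

Lemma linemap_comp M k l n (g : box l n) (f : box k l) v :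
  linemap M (bcomp g f) v = linemap M g (linemap M f v).
Proof.
apply: funext => j; rewrite /= /linemap_fun (thr_comp _ _ _ (box_mono (bfunP f))).
by congr (Posz (thr _ _ _ j) - _)%R; apply: funext => i; rewrite /= GRing.subrK.
Qed.

Lemma linemap_id M n v : linemap M (bid n) v = fun i => trunc M (v i).
Proof. by apply: funext => i; rewrite /= /linemap_fun thr_id. Qed.

Lemma linemap_stable (T : Type) M k n (phi : box k n) (f : gpow line_graph n -> T) :
  stable M (fun v : tup int k => f (linemap M phi v)).
Proof.
have E (v : tup int k) i a : trunc M a = trunc M (v i) ->
    linemap M phi (upd v i a) = linemap M phi v.
  rewrite /trunc => e; apply: funext => j /=; rewrite /linemap_fun.
  congr (Posz _ - _)%R; congr (_ j); apply: thr_congr => l t tM.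
  rewrite /upd; case: eqP => // ->; move: e.
  by move: (zpos _) (zpos _) => c d; lia.
by move=> i v; split=> h; rewrite E // !truncE; repeat case: ifP => ?; lia.
Qed.

Definition sact (G : graph) k n (f : scell G n) (phi : box k n) : scell G k :=
  @SCell G k (gmap_comp f (linemap (sbound f) phi))
    (ex_intro _ (sbound f) (@linemap_stable G (sbound f) k n phi f)).

Lemma sactE (G : graph) k n (f : scell G n) (phi : box k n) M v :
  stable M f -> sact f phi v = f (linemap M phi v).
Proof.
by move=> sM; exact: stable_linemap (box_mono (bfunP phi)) (sboundP f) sM.
Qed.

Definition nerve_ob (G : graph) : cSet.
Proof.
refine (@CSet (scell G) (@sact G) _ _).
- move=> n f; apply: scell_eq => v.
  by rewrite (sactE _ _ (sboundP f)) linemap_id stable_trunc //; exact: sboundP.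
- move=> k l n f g h; apply: scell_eq => v.
  rewrite (@sactE _ _ _ _ h (sbound f)); last exact: linemap_stable.
  by rewrite !(sactE _ _ (sboundP f)) linemap_comp.
Defined.

(* The bound M in nerve_act_face is arbitrary, not the one chosen by sbound. *)
Lemma nerve_act_face (G : graph) n (f : nerve_ob G n.+1) (i : 'I_n.+1) eps M v :
  stable M f ->
  act f (bface i eps) v = f (ins i (if eps then M%:Z%R else (- M%:Z)%R) v).
Proof.
move=> sM; rewrite -[LHS]/(sfun (sact f (bface i eps)) v) (sactE _ _ sM) -[in RHS](stable_trunc sM).
congr (sfun f _); apply: funext => j; rewrite /= /linemap_fun /trunc.
congr (Posz _ - _)%R; apply: (@thr_eq (2 * M)); [exact: thr_le|exact: geq_minl|].
move=> t tM; rewrite (thr_lt _ _ (box_mono (boxgen_face _ _)) tM) leq_min tM /=.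
rewrite /face /ins; case: unlift => //.
have Z z s : (s < zpos z) = (Posz s < z)%R by case: z => a /=; lia.
by case: eps; rewrite Z; lia.
Qed.

Lemma nerve_act_degen (G : graph) n (f : nerve_ob G n) (i : 'I_n.+1) v :
  act f (bdegen i) v = f (del i v).
Proof.
rewrite -[LHS]/(sfun (sact f (bdegen i)) v) (sactE _ _ (sboundP f))
  -[in RHS](stable_trunc (sboundP f)).
congr (sfun f _); apply: funext => j; rewrite /= /linemap_fun /trunc.
congr (Posz _ - _)%R; apply: thr_eq; [exact: thr_le|exact: geq_minl|].
by move=> t tM; rewrite (thr_lt _ _ (box_mono (boxgen_degen _)) tM) leq_min tM.
Qed.

Lemma nerve_act_conn (G : graph) n (f : nerve_ob G n.+1) (i : 'I_n.+1) eps v :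
  act f (bconn i eps) v =
    f (mrg (if eps then Order.min else Order.max) i (v : tup int n.+2)).
Proof.
rewrite -[LHS]/(sfun (sact f (bconn i eps)) v) (sactE _ _ (sboundP f))
  -[in RHS](stable_trunc (sboundP f)).
congr (sfun f _); apply: funext => j; rewrite /= /linemap_fun /trunc.
congr (Posz _ - _)%R; apply: thr_eq; [exact: thr_le|exact: geq_minl|].
move=> t tM; rewrite (thr_lt _ _ (box_mono (boxgen_conn _ _)) tM) leq_min tM /=.
have Z z s : (s < zpos z) = (Posz s < z)%R by case: z => a /=; lia.
rewrite /conn /mrg /del; case: ifP => // _.
by case: eps; rewrite !Z; lia.
Qed.

Definition nerve_map_fun (G H : graph) (h : gmap G H) n (f : scell G n) : scell H n.
Proof.
refine (@SCell H n (gmap_comp h f) _).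
by case: (sfunP f) => M sM; exists M => i v; have [a b] := sM i v;
  split=> [/a|/b] /= ->.
Defined.

Definition nerve_map (G H : graph) (h : gmap G H) :
  cmap (nerve_ob G) (nerve_ob H).
Proof.
refine (@CMap (nerve_ob G) (nerve_ob H) (nerve_map_fun h) _).
move=> k n f phi; apply: scell_eq => v.
change (h (sact f phi v) = sact (nerve_map_fun h f) phi v).
rewrite (sactE _ _ (sboundP f)) (@sactE _ _ _ _ _ (sbound f)) //.
by move=> i w; have [a b] := sboundP f i w; split=> [/a|/b] /= ->.
Defined.

Definition nerve : functor graph_monoidal cSet_monoidal.
Proof.
by refine (@Functor graph_monoidal cSet_monoidal nerve_ob nerve_map _ _) => *;
  apply: cmap_eq => n f; exact: scell_eq.
Defined.

(* Main.v *)
Require Import Defs.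
From mathcomp Require Import all_boot.
From mathcomp Require Import ssralg ssrint boolp zify.
Import Defs.

Set Implicit Arguments.
Unset Strict Implicit.
Unset Printing Implicit Defensive.

(** The geometric product is a Day convolution, so a map out of [X ⊗ Y] is the
same thing as a family of maps [X p * Y q -> Z (p + q)] that is natural for the
tensor product of the box category.  Hence a lax monoidal structure on a functor
[F] into cubical sets amounts to an exterior multiplication of cells
[F a p * F b q -> F (a ⊗ b) (p + q)], with a unit 0-cell of [F munit], that is
natural, associative and unital up to the casts along the laws of addition which
are the structural maps of the box category ([external_product_lax]).

For both nerves the exterior product of [x : L^p -> G] and [y : L^q -> H], with
[L] a path or the line, is [(x ⊗ y) : L^(p + q) -> G ⊗ H], through the
identification of [L^(p + q)] with [L^p ⊗ L^q].  Associativity and unitality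
then hold on the nose, up to reindexing of coordinates.  What remains is that
cube maps act compatibly: a box map is extended to the grid one threshold at a
time, so the extension of [f ⊗ g] is the extension of [f] on the first block of
coordinates and that of [g] on the second ([thr_tfst], [thr_tsnd]), and the
extension of a cast only recasts, apart from a truncation to the grid
([thr_bcast]).  On the line, a cell acts through the grid of any of its
stability bounds; bounds may be enlarged ([stable_leq]), so a common bound for
[x], [y] and their product reduces this case to the same computation. *)

(** * External products on functors into cubical sets *)

(** The last three axioms compare cells whose dimensions are equal only
propositionally; acting by the associator and unitors of the box category is
what makes both sides cells of the same dimension. *)
Record external_product (C : monoidal) (F : functor C cSet_monoidal) : Type :=
  ExternalProduct {
    ext : forall (a b : C) p q,
      (F a : cSet) p -> (F b : cSet) q -> (F (tens a b) : cSet) (p + q);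
    ext_unit : (F munit : cSet) 0;
    ext_act : forall (a b : C) p q p' q' (x : (F a : cSet) p)
        (y : (F b : cSet) q) (f : box p' p) (g : box q' q),
      ext (act x f) (act y g) = act (ext x y) (btens f g);
    ext_nat : forall (a a' b b' : C) (f : hom a a') (g : hom b b') p q
        (x : (F a : cSet) p) (y : (F b : cSet) q),
      ext ((fmap F f : cmap _ _) p x) ((fmap F g : cmap _ _) q y) =
      (fmap F (tensm f g) : cmap _ _) (p + q) (ext x y);
    ext_assoc : forall (a b c : C) p q r (x : (F a : cSet) p)
        (y : (F b : cSet) q) (z : (F c : cSet) r),
      (fmap F (assoc a b c) : cmap _ _) (p + q + r) (ext (ext x y) z) =
      act (ext x (ext y z)) (bassoc p q r);
    ext_lunit : forall (a : C) p (x : (F a : cSet) p),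
      (fmap F (lunit a) : cmap _ _) (0 + p) (ext ext_unit x) =
      act x (blunit p);
    ext_runit : forall (a : C) p (x : (F a : cSet) p),
      (fmap F (runit a) : cmap _ _) (p + 0) (ext x ext_unit) =
      act x (brunit p) }.
Arguments ext {C F} e {a b p q} x y : rename.
Arguments ext_unit {C F} e : rename.

Definition ext_mu_fun (C : monoidal) (F : functor C cSet_monoidal)
    (E : external_product F) (a b : C) k (w : gcell (F a) (F b) k) :
    (F (tens a b) : cSet) k :=
  grec (fun p q x y f => act (ext E x y) f) w.

(** The formula respects the relation generating the coend precisely because the
external product is natural in the two cube variables. *)
Lemma ext_mu_funE (C : monoidal) (F : functor C cSet_monoidal)
    (E : external_product F) (a b : C) k p q (x : (F a : cSet) p)
    (y : (F b : cSet) q) (f : box k (p + q)) :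
  ext_mu_fun E (gmk x y f) = act (ext E x y) f.
Proof.
by rewrite /ext_mu_fun grecE // => p1 *; rewrite ext_act act_comp.
Qed.

Definition ext_mu (C : monoidal) (F : functor C cSet_monoidal)
    (E : external_product F) (a b : C) :
  cmap (gprod (F a) (F b)) (F (tens a b)).
Proof.
refine (@CMap (gprod (F a) (F b)) (F (tens a b)) (@ext_mu_fun C F E a b) _).
by move=> m n w h; elim/gcell_ind: w => *;
  rewrite /= gactE !ext_mu_funE act_comp.
Defined.

Definition yoneda (X : cSet) n (u : X n) : cmap (cube n) X :=
  @CMap (cube n) X (fun k f => act u f) (fun k l f g => act_comp u f g).

(** Both sides of each coherence law are determined by the generators
[gmk x y f] of the geometric product.  In the associativity and unit laws an
inner generator leaves its own box map on one factor; writing the other factor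
as acted on by an identity, [ext_act] moves that box map outside, where the
law for cells applies. *)
Definition external_product_lax (C : monoidal) (F : functor C cSet_monoidal)
  (E : external_product F) : lax_structure F.
Proof.
refine (@LaxStructure C cSet_monoidal F (ext_mu E)
  (yoneda (ext_unit E)) _ _ _ _).
- move=> a a' b b' f g; apply: cmap_eq => k; elim/gcell_ind => p q x y h.
  by rewrite /= gmap_funE !ext_mu_funE ext_nat cfun_nat.
- move=> a b c; apply: cmap_eq => k; elim/gcell_ind => d r v z h.
  elim/gcell_ind: v => p q x y f.
  rewrite /= gassoc_funE !gmap_funE /= !ext_mu_funE act_id cfun_nat.
  rewrite -{1}(act_id z) ext_act cfun_nat ext_assoc.
  by rewrite !act_comp.
- move=> a; apply: cmap_eq => k; elim/gcell_ind => p q u x f.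
  rewrite /= glunit_funE gmap_funE /= ext_mu_funE cfun_nat.
  by rewrite -{1}(act_id x) ext_act cfun_nat ext_lunit !act_comp.
- move=> a; apply: cmap_eq => k; elim/gcell_ind => p q x u f.
  rewrite /= grunit_funE gmap_funE /= ext_mu_funE cfun_nat.
  by rewrite -{1}(act_id x) ext_act cfun_nat ext_runit !act_comp.
Defined.

(** * Products of maps out of powers of a graph *)

(** Two adjacent vertices of a power differ in a single coordinate, which lies in
one of the two blocks; the other block is then constant, as an edge of [⊗]
requires. *)
Lemma gpow_split_sim (L : graph) p q (v w : gpow L (p + q)) : sim v w ->
  @sim (gtens (gpow L p) (gpow L q)) (tfst v, tsnd v) (tfst w, tsnd w).
Proof.
move=> [->|[i [ei ej]]]; first by left.
apply/gtens_simE => /=; case: (split_ordP i) => [j e|j e]; subst i.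
- right; split; last first.
    right; exists j; split=> // l /eqP lj; apply: ej; apply/eqP.
    by rewrite (inj_eq (@lshift_inj _ _)).
  by apply: funext => l; apply: ej; apply/eqP; rewrite eq_rlshift.
- left; split; last first.
    right; exists j; split=> // l /eqP lj; apply: ej; apply/eqP.
    by rewrite (inj_eq (@rshift_inj _ _)).
  by apply: funext => l; apply: ej; apply/eqP; rewrite eq_lrshift.
Qed.

Definition gpow_split (L : graph) p q :
    gmap (gpow L (p + q)) (gtens (gpow L p) (gpow L q)) :=
  @GMap (gpow L (p + q)) (gtens (gpow L p) (gpow L q))
    (fun v => (tfst v, tsnd v)) (@gpow_split_sim L p q).

Definition gpow_ext (L G H : graph) p q (x : gmap (gpow L p) G)
    (y : gmap (gpow L q) H) : gmap (gpow L (p + q)) (gtens G H) :=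
  gmap_comp (gtens_map x y) (gpow_split L p q).

Definition const_gmap (G H : graph) (h : H) : gmap G H :=
  @GMap G H (fun=> h) (fun _ _ _ => or_introl erefl).

Lemma tfst_tfst_tcast A p q r (v : tup A (p + q + r)) :
  tfst (tfst v) = tfst (tcast (esym (addnA p q r)) v).
Proof. by apply: funext => i; congr v; apply: val_inj. Qed.

Lemma tsnd_tfst_tcast A p q r (v : tup A (p + q + r)) :
  tsnd (tfst v) = tfst (tsnd (tcast (esym (addnA p q r)) v)).
Proof. by apply: funext => i; congr v; apply: val_inj. Qed.

Lemma tsnd_tsnd_tcast A p q r (v : tup A (p + q + r)) :
  tsnd v = tsnd (tsnd (tcast (esym (addnA p q r)) v)).
Proof. by apply: funext => i; congr v; apply: val_inj; rewrite /= addnA. Qed.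

Lemma tsnd_tcast0 A p (v : tup A (0 + p)) : tsnd v = tcast (add0n p) v.
Proof. by apply: funext => i; congr v; apply: val_inj. Qed.

Lemma tfst_tcast0 A p (v : tup A (p + 0)) : tfst v = tcast (addn0 p) v.
Proof. by apply: funext => i; congr v; apply: val_inj. Qed.

(** * Threshold extensions of tensor products and casts *)

(** The tensor of box maps acts on each threshold vector blockwise, so the count
of thresholds in a coordinate of the first block only sees [f]. *)
Lemma thr_tfst N p q p' q' (f : box p' p) (g : box q' q) v :
  tfst (thr N (btens f g) v) = thr N f (tfst v).
Proof.
apply: funext => i; apply: eq_bigr => t _.
by rewrite /= /tcat (unsplitK (inl i : 'I_p + 'I_q)).
Qed.

Lemma thr_tsnd N p q p' q' (f : box p' p) (g : box q' q) v :
  tsnd (thr N (btens f g) v) = thr N g (tsnd v).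
Proof.
apply: funext => i; apply: eq_bigr => t _.
by rewrite /= /tcat (unsplitK (inr i : 'I_p + 'I_q)).
Qed.

(** A cast is the identity on coordinates, and [thr] counts only thresholds below
[N]: this is where the truncation comes from. *)
Lemma thr_bcast N p q (e : p = q) v i :
  thr N (bcast e) v i = minn N (tcast e v i).
Proof. exact: (thr_id N v). Qed.

Lemma pathmap_tfst m p q p' q' (f : box p' p) (g : box q' q) v :
  tfst (pathmap m (btens f g) v) = pathmap m f (tfst v).
Proof.
apply: funext => i; apply: val_inj; rewrite /tfst /= !pathmap_val.
exact: (congr1 (@^~ i) (thr_tfst m f g (fun j => v j : nat))).
Qed.

Lemma pathmap_tsnd m p q p' q' (f : box p' p) (g : box q' q) v :
  tsnd (pathmap m (btens f g) v) = pathmap m g (tsnd v).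
Proof.
apply: funext => i; apply: val_inj; rewrite /tsnd /= !pathmap_val.
exact: (congr1 (@^~ i) (thr_tsnd m f g (fun j => v j : nat))).
Qed.

Lemma pathmap_bcast m p q (e : p = q) v : pathmap m (bcast e) v = tcast e v.
Proof.
apply: funext => i; apply: val_inj; rewrite /= pathmap_val thr_bcast.
by apply/minn_idPr; rewrite -ltnS; exact: ltn_ord.
Qed.

Lemma linemap_tfst M p q p' q' (f : box p' p) (g : box q' q) v :
  tfst (linemap M (btens f g) v) = linemap M f (tfst v).
Proof.
apply: funext => i; rewrite /tfst /= /linemap_fun; congr (Posz _ - _)%R.
exact: (congr1 (@^~ i) (thr_tfst (2 * M) f g (fun j => zpos (v j + M%:Z)%R))).
Qed.

Lemma linemap_tsnd M p q p' q' (f : box p' p) (g : box q' q) v :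
  tsnd (linemap M (btens f g) v) = linemap M g (tsnd v).
Proof.
apply: funext => i; rewrite /tsnd /= /linemap_fun; congr (Posz _ - _)%R.
exact: (congr1 (@^~ i) (thr_tsnd (2 * M) f g (fun j => zpos (v j + M%:Z)%R))).
Qed.

(** [linemap] of a cast truncates to the grid of the stability bound, a
truncation that a stable map does not see. *)
Lemma sact_bcast (G : graph) p q (e : p = q) (f : scell G q) v :
  sact f (bcast e) v = f (tcast e v).
Proof.
rewrite (sactE _ _ (sboundP f)) -[RHS](stable_trunc (sboundP f)).
by congr (f _); apply: funext => i; rewrite /= /linemap_fun thr_bcast.
Qed.

(** * The nerves of maps out of finite grids *)

Definition nerve_m_ext m : external_product (nerve_m m).
Proof.
refine (@ExternalProduct graph_monoidal (nerve_m m)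
  (fun G H p q => @gpow_ext (path_graph m) G H p q)
  (const_gmap _ (ord0 : path_graph 0)) _ _ _ _ _).
- move=> G H p q p' q' x y f g; apply: gmap_eq => v.
  change ((x (pathmap m f (tfst v)), y (pathmap m g (tsnd v))) =
    gpow_ext x y (pathmap m (btens f g) v)).
  by rewrite -(pathmap_tfst f g) -(pathmap_tsnd f g).
- by move=> G G' H H' f g p q x y; apply: gmap_eq.
- move=> G H K p q r x y z; apply: gmap_eq => v.
  rewrite -[RHS]/(gpow_ext x (gpow_ext y z) (pathmap m (bassoc p q r) v)).
  rewrite pathmap_bcast /=.
  by rewrite tfst_tfst_tcast tsnd_tfst_tcast tsnd_tsnd_tcast.
- move=> G p x; apply: gmap_eq => v.
  by rewrite -[RHS]/(x (pathmap m (blunit p) v)) pathmap_bcast /= tsnd_tcast0.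
- move=> G p x; apply: gmap_eq => v.
  by rewrite -[RHS]/(x (pathmap m (brunit p) v)) pathmap_bcast /= tfst_tcast0.
Defined.

(** * The stable nerve *)

(** A value of a coordinate beyond [M'] and [M'] itself are both replaced by [M]
without changing [f], so they give the same value. *)
Lemma stable_leq (T : Type) n M M' (f : tup int n -> T) :
  M <= M' -> stable M f -> stable M' f.
Proof.
rewrite leq_eqVlt => /orP[/eqP <- //|MM'] sM i v.
have updK a b : upd (upd v i a) i b = upd v i b.
  by apply: funext => j; rewrite /upd; case: eqP.
have updE a : upd v i a i = a by rewrite /upd eqxx.
have [h1 h2] := sM i v; split=> h.
- (* Strictness of [M < M'] lets stability at [M] apply to the value [M']. *)
  have [k _] := sM i (upd v i M'%:Z%R).
  by rewrite -k ?updK ?updE ?h1 //; lia.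
- have [_ k] := sM i (upd v i (- M'%:Z)%R).
  by rewrite -k ?updK ?updE ?h2 //; lia.
Qed.

Lemma upd_lshift_tfst A p q (v : tup A (p + q)) i a :
  tfst (upd v (lshift q i) a) = upd (tfst v) i a.
Proof.
by apply: funext => j; rewrite /tfst /upd (inj_eq (@lshift_inj _ _)).
Qed.
Lemma upd_lshift_tsnd A p q (v : tup A (p + q)) i a :
  tsnd (upd v (lshift q i) a) = tsnd v.
Proof. by apply: funext => j; rewrite /tsnd /upd eq_rlshift. Qed.
Lemma upd_rshift_tfst A p q (v : tup A (p + q)) i a :
  tfst (upd v (rshift p i) a) = tfst v.
Proof. by apply: funext => j; rewrite /tfst /upd eq_lrshift. Qed.
Lemma upd_rshift_tsnd A p q (v : tup A (p + q)) i a :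
  tsnd (upd v (rshift p i) a) = upd (tsnd v) i a.
Proof.
by apply: funext => j; rewrite /tsnd /upd (inj_eq (@rshift_inj _ _)).
Qed.

(** A change in one coordinate only affects one of the two factors, so any common
bound of the factors works. *)
Lemma stable_ext (G H : graph) p q (x : scell G p) (y : scell H q) :
  exists M, stable M (gpow_ext x y).
Proof.
pose M := maxn (sbound x) (sbound y); exists M => i v.
have sx : stable M x by apply: stable_leq (sboundP x); exact: leq_maxl.
have sy : stable M y by apply: stable_leq (sboundP y); exact: leq_maxr.
rewrite /=; case: (split_ordP i) => [j ->|j ->].
- have [h1 h2] := sx j (tfst v).
  by rewrite !upd_lshift_tfst !upd_lshift_tsnd; split=> [/h1|/h2] ->.
- have [h1 h2] := sy j (tsnd v).
  by rewrite !upd_rshift_tfst !upd_rshift_tsnd; split=> [/h1|/h2] ->.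
Qed.

Definition scell_ext (G H : graph) p q (x : scell G p) (y : scell H q) :
    scell (gtens G H) (p + q) := SCell (stable_ext x y).

Lemma stable0 (T : Type) (f : tup int 0 -> T) : exists M, stable M f.
Proof. by exists 0; case. Qed.

Definition nerve_ext : external_product nerve.
Proof.
refine (@ExternalProduct graph_monoidal nerve
  (fun G H p q => @scell_ext G H p q)
  (SCell (stable0 (const_gmap (gpow line_graph 0) (ord0 : path_graph 0))))
  _ _ _ _ _).
- move=> G H p q p' q' x y f g; apply: scell_eq => v.
  change ((sact x f (tfst v), sact y g (tsnd v)) =
    sact (scell_ext x y) (btens f g) v).
  have [M sM] := stable_ext x y.
  (* The three actions are computed on a single grid, where they agree. *)
  pose N := maxn M (maxn (sbound x) (sbound y)).
  rewrite (@sactE _ _ _ x f N); last by apply: stable_leq (sboundP x); lia.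
  rewrite (@sactE _ _ _ y g N); last by apply: stable_leq (sboundP y); lia.
  rewrite (@sactE _ _ _ (scell_ext x y) _ N); last by apply: stable_leq sM; lia.
  by rewrite -(linemap_tfst N f g) -(linemap_tsnd N f g).
- by move=> G G' H H' f g p q x y; apply: scell_eq.
- move=> G H K p q r x y z; apply: scell_eq => v.
  rewrite -[RHS]/(sact (scell_ext x (scell_ext y z)) (bassoc p q r) v).
  rewrite sact_bcast /=.
  by rewrite tfst_tfst_tcast tsnd_tfst_tcast tsnd_tsnd_tcast.
- move=> G p x; apply: scell_eq => v.
  by rewrite -[RHS]/(sact x (blunit p) v) sact_bcast /= tsnd_tcast0.
- move=> G p x; apply: scell_eq => v.
  by rewrite -[RHS]/(sact x (brunit p) v) sact_bcast /= tfst_tcast0.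
Defined.

Theorem lemma5p28 :
  (forall m : nat, (1 <= m)%N ->
     @lax_monoidal graph_monoidal cSet_monoidal (nerve_m m)) /\
  @lax_monoidal graph_monoidal cSet_monoidal nerve.
Proof.
split=> [m _|]; constructor; apply: external_product_lax.
- exact: nerve_m_ext.
- exact: nerve_ext.
Qed.
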